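(* Let $\Omega\subset\mathbb{R}^d$ be a nonempty, simply connected, bounded Lipschitz domain and let $\omega$ be a domain compactly contained in $\Omega$. Let $y:\bar\Omega\to\mathbb{R}^d$ and $y^n\in C^0(\bar\Omega;\mathbb{R}^d)$, $n\in\mathbb{N}$, be homeomorphisms (of $\bar\Omega$ onto their images) such that $y^n\to y$ strongly in $C^0(\bar\Omega;\mathbb{R}^d)$, i.e. uniformly on $\bar\Omega$. Then $$\limsup_{n\to+\infty}\mathrm{Cap}(y^n(\bar\omega))\le\mathrm{Cap}(y(\bar\omega))\quad(d\ge3),$$ $$\limsup_{n\to+\infty}\mathrm{Cap}(y^n(\bar\omega);y^n(\Omega))\le\mathrm{Cap}(y(\bar\omega);y(\Omega))\quad(d\ge2).$$
   Context: Capacity ($d\ge3$): for compact $E\subset\mathbb{R}^d$, with $2^*=\frac{2d}{d-2}$, $$\mathrm{Cap}(E):=\inf\Big\{\int_{\mathbb{R}^d}|\nabla v|^2\,d\xi:\ v\in L^{2^*}(\mathbb{R}^d),\ \nabla v\in L^2(\mathbb{R}^d;\mathbb{R}^d),\ v\ge1\text{ a.e. in a neighborhood of }E\Big\}.$$ Relative capacity: for $E$ compact, $D$ open, $E\subset D\subset\mathbb{R}^d$, $$\mathrm{Cap}(E;D):=\inf\Big\{\int_D|\nabla v|^2\,d\xi:\ v\in W^{1,2}_0(D),\ v\ge1\text{ a.e. in a neighborhood of }E\Big\},$$ where $W^{1,2}_0(D)$ is the closure of $C^\infty_c(D)$ in $W^{1,2}$. *)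

(* Defs.v *)
From HB Require Import structures.
From mathcomp Require Import all_boot all_order all_algebra.
From mathcomp Require Import all_classical all_reals all_analysis.
Set Implicit Arguments.
Unset Strict Implicit.
Unset Printing Implicit Defensive.
Import Order.TTheory GRing.Theory Num.Theory.
Import numFieldNormedType.Exports.
Local Open Scope classical_set_scope.
Local Open Scope ring_scope.

(* R^d is 'rV[R]_d. Its library norm is the sup norm; the Euclidean structure
   is given by [dotv] below. *)

Fact rV_display : measure_display. Proof. exact: default_measure_display. Qed.

(* The sigma-algebra generated by the coordinates is the Borel one. *)
Section measurable_rV.
Context {R : realType} (n : nat).

Let coord : 'I_n -> 'rV[R]_n -> measurableTypeR R := fun i x => x 0 i.

Let rV_set0 : g_sigma_preimage coord set0.
Proof. exact: sigma_algebra0. Qed.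

Let rV_setC A : g_sigma_preimage coord A -> g_sigma_preimage coord (~` A).
Proof. exact: sigma_algebraC. Qed.

Let rV_bigcup (F : (set 'rV[R]_n)^nat) :
  (forall i, g_sigma_preimage coord (F i)) ->
  g_sigma_preimage coord (\bigcup_i (F i)).
Proof. exact: sigma_algebra_bigcup. Qed.

HB.instance Definition _ := @isMeasurable.Build rV_display
  'rV[R]_n (g_sigma_preimage coord) rV_set0 rV_setC rV_bigcup.

End measurable_rV.

Section lebesgue_rV.
Context {R : realType}.
Local Notation RT := (measurableTypeR R).

Lemma measurable_coord n (i : 'I_n) :
  measurable_fun [set: 'rV[R]_n] (fun x => x 0 i : RT).
Proof.
move=> _ Y mY; rewrite setTI; apply: sub_sigma_algebra => /=.
rewrite -bigcup_seq/=; exists i => /=; first by rewrite mem_index_enum.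
by exists Y => //; rewrite setTI.
Qed.

Lemma measurable_fun_rVP d (T : measurableType d) n (f : T -> 'rV[R]_n) :
  (forall i, measurable_fun [set: T] (fun t => f t 0 i : RT)) ->
  measurable_fun [set: T] f.
Proof.
move=> mf _ Y mY; rewrite setTI.
apply: (@smallest_sub _ (sigma_algebra [set: 'rV[R]_n])
  _ [set A | measurable (f @^-1` A)] _ _ Y mY).
  split => /=.
  - by rewrite preimage_set0.
  - by move=> A mA; rewrite setTD preimage_setC; exact: measurableC.
  - by move=> F mF; rewrite preimage_bigcup; exact: bigcupT_measurable.
rewrite -bigcup_seq => _ [i _ [A mA <-]] /=.
by rewrite setTI; have := mf i measurableT A mA; rewrite setTI.
Qed.

Definition consrV n (p : RT * 'rV[R]_n) : 'rV[R]_n.+1 :=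
  \row_i oapp (p.2 0) p.1 (unlift ord0 i).

Lemma measurable_consrV n : measurable_fun setT (@consrV n).
Proof.
apply: measurable_fun_rVP => i; case: (unliftP ord0 i) => [j|] ->.
  apply: (eq_measurable_fun ((fun x : 'rV[R]_n => x 0 j : RT) \o snd)).
    by move=> p _; rewrite /= mxE liftK.
  by apply: measurableT_comp => //; exact: measurable_coord.
apply: (eq_measurable_fun (fst : RT * 'rV[R]_n -> RT)) => //.
by move=> p _; rewrite /= mxE unlift_none.
Qed.

Definition unconsrV n (x : 'rV[R]_n.+1) : RT * 'rV[R]_n :=
  (x 0 ord0, \row_j x 0 (lift ord0 j)).

Lemma measurable_unconsrV n : measurable_fun setT (@unconsrV n).
Proof.
apply: measurable_fun_pair; first exact: measurable_coord.
apply: measurable_fun_rVP => j.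
apply: (eq_measurable_fun (fun x : 'rV[R]_n.+1 => x 0 (lift ord0 j) : RT)).
  by move=> x _; rewrite mxE.
exact: measurable_coord.
Qed.

Lemma consrVK n : cancel (@consrV n) (@unconsrV n).
Proof.
move=> [a x]; rewrite /unconsrV /consrV mxE unlift_none /=; congr pair.
by apply/rowP => j; rewrite !mxE liftK.
Qed.

Section step.
Variables (n : nat) (m : {sigma_finite_measure set 'rV[R]_n -> \bar R}).

Definition lebesgue_step : set 'rV[R]_n.+1 -> \bar R :=
  pushforward (lebesgue_measure \x m)%E (@consrV n).

Let lebesgue_step0 : lebesgue_step set0 = 0%E.
Proof. by rewrite /lebesgue_step /pushforward preimage_set0 measure0. Qed.

Let lebesgue_step_ge0 A : (0 <= lebesgue_step A)%E.
Proof. exact: (measure_ge0 (lebesgue_measure \x m)%E). Qed.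

Let lebesgue_step_sigma_additive : semi_sigma_additive lebesgue_step.
Proof.
by apply: measure_semi_sigma_additive; exact: measurable_consrV.
Qed.

HB.instance Definition _ := isMeasure.Build _ _ _ lebesgue_step
  lebesgue_step0 lebesgue_step_ge0 lebesgue_step_sigma_additive.

Let lebesgue_step_sigma_finite : sigma_finite setT lebesgue_step.
Proof.
have /sigma_finiteP[F [TF ndF Foo]] := sigma_finiteT (@lebesgue_measure R).
have /sigma_finiteP[G [TG ndG Goo]] := sigma_finiteT m.
exists (fun k => @unconsrV n @^-1` (F k `*` G k)).
  apply/esym; rewrite -subTset => x _; rewrite -preimage_bigcup /=.
  have [k _ Fk] : (\bigcup_i F i) (unconsrV x).1 by rewrite -TF.
  have [l _ Gl] : (\bigcup_i G i) (unconsrV x).2 by rewrite -TG.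
  exists (maxn k l) => //; split.
    by move: Fk; exact/subsetPset/ndF/leq_maxl.
  by move: Gl; exact/subsetPset/ndG/leq_maxr.
move=> k; have [mF Fk] := Foo k; have [mG Gk] := Goo k; split.
  rewrite -[X in measurable X]setTI; apply: measurable_unconsrV => //.
  exact: measurableX.
rewrite /lebesgue_step /pushforward -comp_preimage.
rewrite (_ : _ \o _ = id); last exact/funext/consrVK.
by rewrite preimage_id product_measure1E// lte_mul_pinfty// ge0_fin_numE.
Qed.

HB.instance Definition _ := @Measure_isSigmaFinite.Build _ _ _
  lebesgue_step lebesgue_step_sigma_finite.

End step.

Fixpoint lebesgue_rV n : {sigma_finite_measure set 'rV[R]_n -> \bar R} :=
  if n is n'.+1 then lebesgue_step (lebesgue_rV n')
  else @dirac _ _ (0 : 'rV[R]_0) R.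

Lemma lebesgue_rV_box n (A : 'I_n -> set RT) : (forall i, measurable (A i)) ->
  lebesgue_rV n [set x | forall i, A i (x 0 i)] =
  (\prod_(i < n) lebesgue_measure (A i))%E.
Proof.
elim: n A => [|n IHn] A mA.
  by rewrite big_ord0 /= diracE mem_set// => -[].
have mB : measurable [set x : 'rV[R]_n | forall i, A (lift ord0 i) (x 0 i)].
  rewrite (_ : [set _ | _] =
    \bigcap_(i in setT) (fun x : 'rV[R]_n => x 0 i : RT) @^-1` A (lift ord0 i)).
    apply: fin_bigcap_measurable => // i _; rewrite -[X in measurable X]setTI.
    exact: measurable_coord.
  by apply/seteqP; split => [x Ax i _|x Ax i]; exact: Ax.
rewrite big_ord_recl -(IHn (fun i => A (lift ord0 i)))// -product_measure1E//.
rewrite /= /lebesgue_step /pushforward; congr product_measure1.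
apply/seteqP; split => [p /= Ap|p [/= Ap0 Ap] i].
  split; first by have := Ap ord0; rewrite mxE unlift_none.
  by move=> i /=; have := Ap (lift ord0 i); rewrite mxE liftK.
by rewrite /= mxE; case: (unliftP ord0 i) => [j|] ->.
Qed.

End lebesgue_rV.

Section sobolev.
Context {R : realType} (d : nat).
Implicit Types (D E U : set 'rV[R]_d) (v phi : 'rV[R]_d -> R)
  (g : 'rV[R]_d -> 'rV[R]_d).

Local Notation mu := (lebesgue_rV d : {sigma_finite_measure set _ -> \bar R}).

Definition dotv (x y : 'rV[R]_d) : R := \sum_i x 0 i * y 0 i.

Definition partial (i : 'I_d) phi : 'rV[R]_d -> R :=
  fun x => 'D_(delta_mx 0 i) phi x.

Definition grad phi : 'rV[R]_d -> 'rV[R]_d := fun x => \row_i partial i phi x.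

(* [foldr partial phi s] ranges over all iterated partial derivatives. *)
Definition smooth phi :=
  forall s : seq 'I_d, continuous (foldr partial phi s) /\
    forall i x, derivable (foldr partial phi s) x (delta_mx 0 i).

Definition supp phi : set 'rV[R]_d := closure [set x | phi x != 0].

(* C_c^oo(D), as functions on R^d *)
Definition test_function D phi :=
  [/\ smooth phi, compact (supp phi) & supp phi `<=` D].

(* Functions on [D] are total functions whose values outside [D] are ignored. *)
Definition in_Lp D (p : \bar R) v := v \_ D \in Lfun mu p.

Definition in_Lp_vec D (p : \bar R) g := forall i, in_Lp D p (fun x => g x 0 i).

Definition loc_integrable D v :=
  forall K : set 'rV[R]_d, compact K -> K `<=` D -> mu.-integrable K (EFin \o v).

Definition weak_gradient D v g :=
  [/\ loc_integrable D v, forall i, loc_integrable D (fun x => g x 0 i) &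
    forall phi, test_function D phi -> forall i,
      (\int[mu]_(x in D) (v x * partial i phi x)%:E =
       - \int[mu]_(x in D) (g x 0 i * phi x)%:E)%E].

Definition dirichlet D g : \bar R := (\int[mu]_(x in D) (dotv (g x) (g x))%:E)%E.

Definition sqr_W12norm D v g : \bar R :=
  (\int[mu]_(x in D) (v x ^+ 2)%:E + dirichlet D g)%E.

(* Elements of W^{1,2} are pairs of a function and its weak gradient. *)
Definition W12 D v g :=
  [/\ in_Lp D 2%:E v, in_Lp_vec D 2%:E g & weak_gradient D v g].

Definition W12_0 D v g :=
  W12 D v g /\
  forall e : R, 0 < e -> exists2 phi, test_function D phi &
    (sqr_W12norm D (v \- phi)%R (g \- grad phi)%R < (e ^+ 2)%:E)%E.

Definition ge1_near D E v :=
  exists U, [/\ open U, E `<=` U, U `<=` D &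
    {ae mu, forall x, U x -> 1 <= v x}].

Definition critical_exponent : R := 2 * d%:R / (d%:R - 2).

Definition Cap E : \bar R :=
  ereal_inf [set c | exists v g,
    [/\ in_Lp setT critical_exponent%:E v, weak_gradient setT v g,
        in_Lp_vec setT 2%:E g, ge1_near setT E v & c = dirichlet setT g]].

Definition relCap E D : \bar R :=
  ereal_inf [set c | exists v g,
    [/\ W12_0 D v g, ge1_near D E v & c = dirichlet D g]].

End sobolev.

Section domains.
Context {R : realType} (d : nat).
Implicit Types (A Omega omega : set 'rV[R]_d).

Definition domain A := open A /\ connected A.

Definition boundary A : set 'rV[R]_d := closure A `\` A°.

(* Near each boundary point, after a rotation taking e to the vertical
   direction, Omega is the strict epigraph of a Lipschitz function f defined on
   the hyperplane orthogonal to e. *)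
Definition lipschitz_boundary Omega :=
  forall x0, boundary Omega x0 ->
    exists r : R, exists e : 'rV[R]_d, exists f : 'rV[R]_d -> R,
      [/\ 0 < r, dotv e e = 1, [lipschitz f z | z in [set z | dotv z e = 0]] &
        forall z, ball x0 r z ->
          (Omega z <-> f (z - dotv z e *: e) < dotv z e)].

Definition bounded_lipschitz_domain Omega :=
  [/\ domain Omega, bounded_set Omega & lipschitz_boundary Omega].

Definition path_connected A :=
  forall a b, A a -> A b -> exists c : R -> 'rV[R]_d,
    [/\ {within `[0, 1], continuous c}, c @` `[0, 1] `<=` A, c 0 = a & c 1 = b].

Definition null_homotopic A (c : R -> 'rV[R]_d) :=
  exists H : R * R -> 'rV[R]_d,
    [/\ {within `[0, 1] `*` `[0, 1], continuous H},
        H @` (`[0, 1] `*` `[0, 1]) `<=` A,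
        forall t, t \in `[0, 1] -> H (0, t) = c t,
        forall t, t \in `[0, 1] -> H (1, t) = c 0 &
        forall s, s \in `[0, 1] -> H (s, 0) = c 0 /\ H (s, 1) = c 0].

Definition simply_connected A :=
  path_connected A /\
  forall c : R -> 'rV[R]_d, {within `[0, 1], continuous c} ->
    c @` `[0, 1] `<=` A -> c 0 = c 1 -> null_homotopic A c.

Definition compactly_contained omega Omega :=
  compact (closure omega) /\ closure omega `<=` Omega.

End domains.

Definition homeomorphism_onto_image {T U : topologicalType} (A : set T)
    (f : T -> U) :=
  {within A, continuous f} /\
  exists h : U -> T, {within f @` A, continuous h} /\
    forall x, A x -> h (f x) = x.

(* Main.v *)
Require Import Defs.
From mathcomp Require Import all_boot all_order all_algebra all_fingroup.
From mathcomp Require Import finmap.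
From mathcomp Require Import all_classical all_reals all_analysis.
From mathcomp Require Import measurable_realfun.
From mathcomp Require Import zify ring lra.
Set Implicit Arguments.
Unset Strict Implicit.
Unset Printing Implicit Defensive.
Import Order.TTheory GRing.Theory Num.Theory.
Import numFieldNormedType.Exports.
Local Open Scope classical_set_scope.
Local Open Scope ring_scope.

(** The first inequality holds because the open set on which a competitor [v] for
    [y(closure omega)] is at least 1 contains [yn(closure omega)] for large [n].

    For the second one, a competitor [v] on [D = y(Omega)], with weak gradient [g], is
    replaced by [w = eta v + (1 - eta) psi], where [eta] is a smooth cutoff equal to 1 near
    [y(closure omega)] and [psi] is a smooth soft threshold, at height [e], of a test
    function [phi] close to [v]. Thresholding does not increase the gradient, so convexity
    of the square gives [int |grad w|^2 <= int |g|^2 + small]; and [w] is supported in a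
    compact subset [K] of the interior of [D], since the compact set [{|phi| >= e}] lies in
    the open set [{phi <> 0}], itself contained in [D]. The openness of [D] (invariance of
    domain) is therefore never needed. Finally [K] is contained in [yn(Omega)] for large
    [n]: around each [p] in [K] there is a cube contained in [D], on which [yn o y^-1] is
    uniformly close to the identity, so its image contains [p] by the Poincare-Miranda
    theorem. The latter follows from Kuhn's cubical lemma, proved by counting mod 2. *)

(** * Kuhn's combinatorial lemma *)

(** The obstacle is that [v] may be nonzero all the way to the boundary of [D], while [yn(Omega)]
    need not contain [D]: only compact subsets of the interior are known to be covered eventually.
    Hence a competitor is needed that vanishes off one compact set fixed before [n]. The approximant
    [phi] has compact support but need not be at least 1 near [y(closure omega)], so [v] is kept
    there and given up elsewhere. The price of gluing is the term [(v - psi) grad eta]. It is small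
    in L2 because [v - phi] is small in L2, [|phi - psi| <= 2 e] everywhere, and [grad eta] is
    bounded and carried by a set of finite measure. Young's inequality with weight [t] separates it
    from the convex combination [eta g + (1 - eta) grad psi], leaving the factor [(1 + t)^2] on
    [|g|^2] and [1 + 1/t] on the errors. So [eta] is fixed first, then [t], and only then the
    distance from [v] to [phi] and the height [e]. On the combinatorial side, labels are 0-cochains
    mod 2 and the cup product of their coboundaries plays the role of a degree: it is unchanged when
    a label is modified away from its two faces, and equals 1 for a model labelling. *)

Section cochains.
Variables (F : comNzRingType) (P : Type).
Hypothesis addF2 : forall u : F, u + u = 0.
Implicit Types (a b c : P -> F) (s : seq (P -> F)) (x y : nat -> P).

Lemma addF2K (u v w : F) : v + w + (u + w) = u + v.
Proof. by rewrite addrACA addF2 addr0 addrC. Qed.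

(** The orbits of [h] are pairs on which [f] is constant, so each contributes [u + u]. Comparing
    [enum_rank] selects one element of each pair. *)
Lemma sum_invol_F2 (T : finType) (h : T -> T) (f : T -> F) :
  involutive h -> (forall t, h t != t) -> (forall t, f (h t) = f t) ->
  \sum_t f t = 0.
Proof.
move=> hK hne fh; pose r := @enum_rank T.
rewrite (bigID (fun t => (r t < r (h t))%N)) /= [X in _ + X](reindex_inj (can_inj hK)).
rewrite [X in _ + X](eq_big (fun t => (r t < r (h t))%N) f) ?addF2// => t.
rewrite hK -leqNgt leq_eqVlt; case: eqP => //= /val_inj /enum_rank_inj e.
by have := hne t; rewrite -e eqxx.
Qed.

(* The value on the simplex [x 0, x 1, ...] of the cup product of the coboundaries of the
   0-cochains in [s]; in [cup0], the factor [c] is left undifferentiated. *)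
Fixpoint cup s x : F :=
  if s is a :: s' then (a (x 0) + a (x 1)) * cup s' (x \o S) else 1.

Fixpoint cup0 s1 c s2 x : F :=
  if s1 is a :: s' then (a (x 0) + a (x 1)) * cup0 s' c s2 (x \o S)
  else c (x 0) * cup s2 x.

Lemma eq_cup s x y : (forall m, (m <= size s)%N -> x m = y m) ->
  cup s x = cup s y.
Proof.
elim: s x y => //= a s IHs x y xy; rewrite !xy//; congr (_ * _).
by apply: IHs => m sm; exact: xy.
Qed.

Lemma eq_cup0 s1 c s2 x y :
  (forall m, (m <= size s1 + size s2)%N -> x m = y m) ->
  cup0 s1 c s2 x = cup0 s1 c s2 y.
Proof.
elim: s1 x y => [|a s IHs] x y xy /=; first by rewrite xy// (eq_cup xy).
rewrite !xy//; congr (_ * _).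
by apply: IHs => m sm; exact: xy.
Qed.

Lemma cupE s x :
  cup s x = \prod_(i < size s) (nth (fun=> 0) s i (x i) + nth (fun=> 0) s i (x i.+1)).
Proof.
elim: s x => [|a s IHs] x /=; first by rewrite big_ord0.
by rewrite big_ord_recl IHs.
Qed.

Lemma cup_neq0 s x : cup s x <> 0 -> forall i, (i < size s)%N ->
  nth (fun=> 0) s i (x i) <> nth (fun=> 0) s i (x i.+1).
Proof.
rewrite cupE => s0 i si e; apply: s0.
by rewrite (bigD1 (Ordinal si)) //= e addF2 mul0r.
Qed.

Lemma cupD s1 a b s2 x :
  cup (s1 ++ a :: s2) x + cup (s1 ++ b :: s2) x =
  cup (s1 ++ (fun z => a z + b z) :: s2) x.
Proof.
elim: s1 x => /= [|u s IHs] x; last by rewrite -IHs mulrDr.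
by rewrite -mulrDl addrACA.
Qed.

(** A cup product of coboundaries is a cocycle; [bump m] skips vertex [m], so the sum runs over the
    facets of a simplex. In the induction only the facets omitting vertex 0 or 1 alter the first
    factor; they share the remaining factor [u], and their first factors add up to
    [a (x 0) + a (x 1)]. *)
Lemma coboundary_cup s x :
  \sum_(m < (size s).+2) cup s (x \o bump m) = 0.
Proof.
elim: s x => [|a s IHs] x /=; first by rewrite !big_ord_recr big_ord0 /= add0r addF2.
rewrite 2!big_ord_recl addrA.
rewrite (eq_bigr (fun m => (a (x 0) + a (x 1)) *
  cup s ((x \o S) \o bump (lift ord0 m)))); last first.
  move=> m _; congr (_ * _).
  by apply: eq_cup => n _ /=; congr (x _); rewrite /bump /=; lia.
rewrite -mulr_sumr; pose u := cup s ((x \o S) \o bump (@ord0 (size s).+1)).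
transitivity ((a (x 1) + a (x 2)) * u + (a (x 0) + a (x 2)) * u +
  (a (x 0) + a (x 1)) * \sum_(m < (size s).+1) cup s ((x \o S) \o bump (lift ord0 m))).
  by congr (_ * _ + _ * _ + _).
rewrite -mulrDl addF2K -mulrDr.
by rewrite -(big_ord_recl _ (fun m : 'I_ _ => cup s ((x \o S) \o bump m))) IHs mulr0.
Qed.

(** Leibniz rule: every factor other than [c] is closed, so the coboundary falls on [c] alone. *)
Lemma coboundary_cup0 s1 c s2 x :
  \sum_(m < (size s1 + size s2).+2) cup0 s1 c s2 (x \o bump m) =
  cup (s1 ++ c :: s2) x.
Proof.
elim: s1 x => [|a s IHs] x /=.
  have E : \sum_(m < (size s2).+1) cup s2 (x \o bump (lift ord0 m)) = cup s2 (x \o S).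
    apply: (addrI (cup s2 (x \o S))); rewrite addF2.
    by have := coboundary_cup s2 x; rewrite big_ord_recl.
  rewrite add0n big_ord_recl.
  transitivity (c (x 1) * cup s2 (x \o S) +
    \sum_(m < (size s2).+1) c (x 0) * cup s2 (x \o bump (lift ord0 m))) => //.
  by rewrite -mulr_sumr E -mulrDl addrC.
rewrite -IHs addSn 2!big_ord_recl addrA.
rewrite (eq_bigr (fun m => (a (x 0) + a (x 1)) *
  cup0 s c s2 ((x \o S) \o bump (lift ord0 m)))); last first.
  move=> m _; congr (_ * _).
  by apply: eq_cup0 => n _ /=; congr (x _); rewrite /bump /=; lia.
rewrite -mulr_sumr; pose u := cup0 s c s2 ((x \o S) \o bump (@ord0 (size s + size s2).+1)).
transitivity ((a (x 1) + a (x 2)) * u + (a (x 0) + a (x 2)) * u +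
  (a (x 0) + a (x 1)) * \sum_(m < (size s + size s2).+1)
    cup0 s c s2 ((x \o S) \o bump (lift ord0 m))).
  by congr (_ * _ + _ * _ + _).
by rewrite -mulrDl addF2K -mulrDr [in RHS]big_ord_recl.
Qed.

Lemma cup_eq0 s x i : (i < size s)%N ->
  nth (fun=> 0) s i (x i) = nth (fun=> 0) s i (x i.+1) -> cup s x = 0.
Proof.
by move=> si e; rewrite cupE (bigD1 (Ordinal si)) //= e addF2 mul0r.
Qed.

(** Meant for a facet lying in a face of the grid orthogonal to direction [i]: factor [i] is then a
    coboundary between equal values, or it is [c] itself and vanishes. Constancy is asked for all
    pairs of vertices because the factors behind [c] use vertices one step before their position in
    the list. *)
Lemma cup0_eq0 s1 c s2 x i : (i <= size s1 + size s2)%N ->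
  (forall m m', (m <= size s1 + size s2)%N -> (m' <= size s1 + size s2)%N ->
    i != size s1 ->
    nth (fun=> 0) (s1 ++ c :: s2) i (x m) = nth (fun=> 0) (s1 ++ c :: s2) i (x m')) ->
  (i = size s1 -> c (x i) = 0) -> cup0 s1 c s2 x = 0.
Proof.
elim: s1 x i => [|a s IHs] x [|i] //= ile H c0.
- by rewrite c0// mul0r.
- rewrite (@cup_eq0 s2 x i) ?mulr0//; by apply: H => //; lia.
- by rewrite (H 0 1)%N// addF2 mul0r.
- rewrite (IHs (x \o S) i) ?mulr0//=.
    by move=> m m' hm hm' ii; apply: H => //; lia.
  by move=> ii; apply: c0; rewrite ii.
Qed.

End cochains.

Section kuhn.
Variables (F : comNzRingType) (n k : nat).
Hypothesis addF2 : forall u : F, u + u = 0.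
Hypothesis k_gt0 : (0 < k)%N.
Local Notation d := n.+1.
Local Notation pt := {ffun 'I_d -> nat}.
Implicit Types (q : pt) (t : {perm 'I_d}) (a b c : pt -> F)
  (s : seq (pt -> F)).

(* Kuhn's triangulation: from the corner [q] of a unit cube, coordinate [i] is incremented
   at time [t i]; the simplex has the vertices at times 0, ..., d. *)
Definition vertex q t (m : nat) : pt := [ffun i => (q i + (t i < m))%N].

Definition base (q : {ffun 'I_d -> 'I_k}) : pt := [ffun i => val (q i)].

(** A facet interior to the cube belongs to exactly two simplices: exchanging the coordinates
    incremented at times [m - 1] and [m] changes vertex [m] only, which is the omitted one. *)
Lemma vertex_swap (q : pt) (f : (nat -> pt) -> F) (m : nat) :
  (forall x y, x =1 y -> f x = f y) -> (0 < m < d)%N ->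
  \sum_t f (vertex q t \o bump m) = 0.
Proof.
move=> cf /andP[m0 md].
have m1d : (m.-1 < d)%N by lia.
pose u : 'I_d := Ordinal m1d; pose v : 'I_d := Ordinal md.
apply: (sum_invol_F2 addF2 (h := fun t => t * tperm u v)%g) => [t|t|t].
- by rewrite -mulgA tperm2 mulg1.
- apply/eqP => /(congr1 (mulg t^-1))%g; rewrite mulKg mulVg => /permP /(_ u).
  by rewrite tpermL perm1 => /(congr1 val) /=; lia.
- apply: cf => j; apply/ffunP => i; rewrite !ffunE permM.
  congr (_ + _)%N; congr nat_of_bool.
  rewrite /bump; case: tpermP => [->|->|_ _] //=; lia.
Qed.

Lemma ord_pred_inj : injective (@ord_pred d).
Proof. exact: can_inj (@ord_predK d). Qed.

Definition rot1 : {perm 'I_d} := perm ord_pred_inj.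

Lemma rot1E (i : 'I_d) (m : nat) : (m <= n)%N ->
  ((i < m.+1) = (i == ord0) + (rot1 i < m) :> nat)%N.
Proof.
move=> mn; rewrite permE -val_eqE /=; case: i => [[|i] /= ii].
  by rewrite modn_small//; lia.
by rewrite modnDr modn_small; lia.
Qed.

Definition shift1 t q : pt := [ffun i => (q i + (t i == ord_max))%N].

(** The facet without the first vertex is also the facet without the last vertex of a simplex in the
    next cube, namely the one that starts a step further, in the direction formerly incremented
    first and now incremented last. *)
Lemma vertex_rot q t m : (m <= n)%N ->
  vertex q t m.+1 = vertex (shift1 (t * rot1)%g q) (t * rot1)%g m.
Proof.
move=> mn; apply/ffunP => i; rewrite !ffunE permM rot1E// addnA.
congr (_ + _ + _)%N; congr nat_of_bool.
rewrite permE -val_eqE -[RHS]val_eqE /=; case: (t i) => [[|j] /= jj].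
  by rewrite modn_small// !eqxx.
by rewrite modnDr modn_small; lia.
Qed.

(* Since [f] vanishes on both opposite faces, the shift may be taken cyclically. *)
Lemma sum_shift1 t (f : pt -> F) :
  (forall q, q ((t^-1)%g ord_max) = 0%N \/ q ((t^-1)%g ord_max) = k -> f q = 0) ->
  \sum_q f (shift1 t (base q)) = \sum_q f (base q).
Proof.
move=> f0; pose l := (t^-1)%g ord_max.
have tl i : (t i == ord_max) = (i == l).
  by rewrite /l -(inj_eq (@perm_inj _ t) i) permKV.
pose h (q : {ffun 'I_d -> 'I_k}) := [ffun i => if i == l then ordS (q i) else q i].
have hi : injective h.
  move=> q q' e; apply/ffunP => i; have := congr1 (fun g : {ffun _ -> _} => g i) e.
  by rewrite !ffunE; case: eqP => // _; apply: (can_inj (@ordSK k)).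
rewrite [RHS](reindex_inj hi); apply: eq_bigr => q _.
have [ql|ql] := ltnP (q l).+1 k.
  congr f; apply/ffunP => i; rewrite !ffunE tl; case: eqP => [->|_].
    by rewrite /= modn_small// addn1.
  by rewrite addn0.
have qk : (q l).+1 = k by apply/eqP; rewrite eqn_leq ql ltn_ord.
rewrite !f0//; first by left; rewrite -/l !ffunE eqxx /= qk modnn.
by right; rewrite -/l !ffunE tl eqxx addn1.
Qed.

(* A discrete integral of [d s_0 /\ ... /\ d s_n] mod 2: by [total_eq0] (Stokes) it depends
   only on the values of the labels on the boundary of the grid. *)
Definition total s := \sum_(q : {ffun 'I_d -> 'I_k}) \sum_t cup s (vertex (base q) t).

(** This is what makes the coboundary of label [i] vanish along the two faces orthogonal to
    direction [i]. *)
Definition flat s := forall (i : 'I_d) (x y : pt), x i = y i -> x i = 0%N \/ x i = k ->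
  nth (fun=> 0) s i x = nth (fun=> 0) s i y.

(** Discrete Stokes: the summand is a coboundary, so the total is a sum over facets. Facets inside a
    cube and facets between neighbouring cubes cancel in pairs, and those on the boundary of the
    grid carry the value 0. *)
Lemma total_eq0 s1 c s2 : (size s1 + size s2)%N = n ->
  (forall i : 'I_d, i = size s1 :> nat -> forall x : pt, x i = 0%N \/ x i = k -> c x = 0) ->
  flat (s1 ++ c :: s2) -> total (s1 ++ c :: s2) = 0.
Proof.
move=> sz c0 fl.
pose G m := \sum_(q : {ffun 'I_d -> 'I_k}) \sum_t cup0 s1 c s2 (vertex (base q) t \o bump m).
have -> : total (s1 ++ c :: s2) = \sum_(m < d.+1) G m.
  rewrite [RHS]exchange_big; apply: eq_bigr => q _.
  rewrite [RHS]exchange_big; apply: eq_bigr => t _.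
  by rewrite -(coboundary_cup0 addF2) sz.
(* The intermediate [m] give facets interior to a cube; what remains is the omission of the first
   and of the last vertex. *)
rewrite big_ord_recl big_ord_recr /= big1 ?add0r; last first.
  move=> m _; rewrite /G big1// => q _.
  apply: (@vertex_swap _ (cup0 s1 c s2)).
    by move=> x y xy; apply: eq_cup0 => ? _.
  by rewrite /bump /=; have := ltn_ord m; lia.
pose W t q := cup0 s1 c s2 (vertex q t).
have -> : G (bump 0 n) = \sum_t \sum_q W t (base q).
  rewrite [RHS]exchange_big; apply: eq_bigr => q _; apply: eq_bigr => t _.
  by apply: eq_cup0 => m mm /=; congr (vertex _ _ _); rewrite /bump; lia.
have -> : G 0%N = \sum_t \sum_q W t (shift1 t (base q)).
  rewrite /G exchange_big [RHS](reindex_inj (mulIg rot1)) /=.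
  apply: eq_bigr => t _; apply: eq_bigr => q _.
  by apply: eq_cup0 => m mm /=; rewrite -vertex_rot -?sz.
rewrite (eq_bigr (fun t => \sum_q W t (base q))) ?addF2// => t _.
apply: sum_shift1 => q; set l := (t^-1)%g ord_max => ql.
(* Direction [l] is incremented last, so the facet without the last vertex stays in a hyperplane
   where coordinate [l] is constant. *)
have vl m : (m <= n)%N -> vertex q t m l = q l.
  by move=> mn; rewrite ffunE /l permKV /=; lia.
rewrite /W; apply: (@cup0_eq0 F pt addF2 s1 c s2 (vertex q t) l); rewrite ?sz.
- by rewrite -ltnS.
- by move=> m m' mn m'n _; apply: fl; rewrite !vl.
- by move=> e; apply: (c0 l) => //; rewrite vl -1?ltnS.
Qed.

Definition admissible (i : 'I_d) a := forall x : pt, (x i = 0%N -> a x = 0) /\ (x i = k -> a x = 1).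

Definition threshold (i : 'I_d) (x : pt) : F := (0 < x i)%N%:R.

(** Factor [i] is nonzero only if coordinate [i] jumps from 0 to 1 exactly between times [i] and
    [i + 1]. This forces the corner cube and the identity permutation, so a single simplex
    contributes. *)
Lemma total_threshold : total (mkseq (fun i => threshold (inord i)) d) = 1.
Proof.
pose z : {ffun 'I_d -> 'I_k} := [ffun=> Ordinal k_gt0].
set L := mkseq _ _.
have cE (q : {ffun 'I_d -> 'I_k}) t : cup L (vertex (base q) t) =
    \prod_(i < d) ((val (q i) == 0%N) && (t i == i))%:R.
  rewrite cupE /L size_mkseq; apply: eq_bigr => i _.
  rewrite nth_mkseq// inord_val /threshold !ffunE -val_eqE /=.
  rewrite ltnS; case: (val (q i)) => [|w]; last by rewrite !addSn addF2.
  by rewrite !add0n !lt0b; case: (ltngtP (t i) i) => _; rewrite ?addF2 ?addr0 ?add0r.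
rewrite /total; under eq_bigr do under eq_bigr do rewrite cE.
rewrite (bigD1 z)//= (bigD1 1%g)//=.
rewrite [\prod_(_ < _) _]big1 => [|i _]; last by rewrite ffunE perm1 !eqxx.
rewrite big1 => [|t t1]; last first.
  have /existsP[i ti] : [exists i, t i != i].
    apply: contraNT t1 => /existsPn h; apply/eqP/permP => i.
    by rewrite perm1; apply/eqP; have := h i; rewrite negbK.
  by rewrite (bigD1 i)//= (negPf ti) andbF mul0r.
rewrite addr0 big1 ?addr0// => q qz; apply: big1 => t _.
have /existsP[i qi] : [exists i, val (q i) != 0%N].
  apply: contraNT qz => /existsPn h; apply/eqP/ffunP => i.
  by apply/val_inj; rewrite ffunE /=; apply/eqP; have := h i; rewrite negbK.
by rewrite (bigD1 i)//= (negPf qi) mul0r.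
Qed.

(** The thresholds are exchanged for the given labels one at a time without changing [total], which
    is therefore 1. Some simplex then has a nonzero cup product, and its edge from vertex [i] to
    vertex [i + 1] shows both values of label [i]. *)
Lemma kuhn (a : 'I_d -> pt -> F) : (forall i, admissible i (a i)) ->
  (forall i x, a i x = 0 \/ a i x = 1) ->
  exists q : {ffun 'I_d -> 'I_k}, forall i, exists x y : pt,
    [/\ (forall j, (q j <= x j <= (q j).+1)%N), (forall j, (q j <= y j <= (q j).+1)%N),
      a i x = 0 & a i y = 1].
Proof.
move=> adm ab; pose A i := a (inord i); pose B i := threshold (inord i).
have admB i : admissible i (threshold i).
  by move=> x; split => xi; rewrite /threshold xi// k_gt0.
pose hyb j := map B (iota 0 j) ++ map A (iota j (d - j)).
have hybE j : (j <= d)%N -> total (hyb j) = 1.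
  move=> jd; rewrite -total_threshold.
  have -> : mkseq (fun i => threshold (inord i)) d = hyb d.
    by rewrite /hyb subnn cats0.
  elim: {j jd} (d - j)%N {-2}j (subnKC jd) => [|m IHm] j jm.
    by rewrite -jm addn0.
  rewrite -(IHm j.+1); last by rewrite addSnnS.
  (* In characteristic 2 the two totals agree if their sum vanishes. By multilinearity that sum is
     the total of the list with [A j + B j] in position [j], which is zero on both faces orthogonal
     to direction [j]. *)
  suff /(congr1 (+%R^~ (total (hyb j.+1)))) : total (hyb j) + total (hyb j.+1) = 0.
    by rewrite -addrA addF2 add0r addr0.
  pose s2 := map A (iota j.+1 m).
  have hj : hyb j = map B (iota 0 j) ++ A j :: s2.
    by rewrite /hyb (_ : (d - j)%N = m.+1)//; lia.
  have hj1 : hyb j.+1 = map B (iota 0 j) ++ B j :: s2.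
    rewrite /hyb (_ : (d - j.+1)%N = m); last by lia.
    by rewrite -[X in iota 0 X]addn1 iotaD map_cat -catA.
  have jd : (j < d)%N by lia.
  rewrite hj hj1 /total -big_split/=.
  under eq_bigr do (rewrite -big_split/=; under eq_bigr do rewrite cupD).
  have nthE i : (i < d)%N -> i != j ->
      nth (fun=> 0) (map B (iota 0 j) ++ (fun z => A j z + B j z) :: s2) i =
      (if (i < j)%N then B i else A i).
    move=> id ij; rewrite nth_cat size_map size_iota; case: ltnP => iltj.
      by rewrite (nth_map 0%N) ?size_iota// nth_iota.
    have -> : (i - j)%N = (i - j.+1).+1 by lia.
    rewrite /= (nth_map 0%N) ?nth_iota ?size_iota; [|lia..].
    by congr A; lia.
  have c0 (i : 'I_d) : i = j :> nat -> forall x : pt, x i = 0%N \/ x i = k ->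
      A j x + B j x = 0.
    move=> <- x; rewrite /A /B inord_val.
    have [a0 a1] := adm i x; have [b0 b1] := admB i x.
    by case=> xi; [rewrite a0// b0// addr0|rewrite a1// b1// addF2].
  apply: total_eq0.
  - by rewrite !size_map !size_iota; lia.
  - by move=> i; rewrite size_map size_iota => ij x; exact: c0.
  - move=> i x z xz xi; have [ij|ij] := eqVneq (i : nat) j.
      rewrite ij nth_cat size_map size_iota ltnn subnn /=.
      by rewrite !(c0 i)// -xz.
    rewrite nthE//; case: ifP => _; rewrite /A /B inord_val.
      have [b0 b1] := admB i x; have [d0 d1] := admB i z.
      by case: xi => xi; [rewrite b0// d0// -xz|rewrite b1// d1// -xz].
    have [b0 b1] := adm i x; have [d0 d1] := adm i z.
    by case: xi => xi; [rewrite b0// d0// -xz|rewrite b1// d1// -xz].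
have t1 : total (map A (iota 0 d)) = 1 := hybE 0%N isT.
have /existsP[q /existsP[t /eqP qt]] : [exists q : {ffun 'I_d -> 'I_k},
    exists t, cup (map A (iota 0 d)) (vertex (base q) t) != 0].
  apply: contra_eqT t1 => /existsPn h; rewrite /total big1 1?eq_sym ?oner_neq0// => q _.
  rewrite big1// => t _; have := h q; rewrite negb_exists => /forallP/(_ t).
  by rewrite negbK => /eqP.
exists q => i; have := cup_neq0 addF2 qt (i := i).
rewrite size_map size_iota (nth_map 0%N) ?size_iota// nth_iota// /A inord_val.
move=> /(_ (ltn_ord i)); set x := vertex _ _ _; set x' := vertex _ _ _ => xx'.
have vq m j : (q j <= vertex (base q) t m j <= (q j).+1)%N.
  by rewrite !ffunE; case: (_ < _)%N; rewrite ?addn0 ?addn1 !leqnn ?leqnSn.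
case: (ab i x) (ab i x') => e [] e'; try by case: xx'; rewrite e e'.
  by exists x, x'; split=> // j; exact: vq.
by exists x', x; split=> // j; exact: vq.
Qed.

End kuhn.

Lemma kuhn_bool (n k : nat) (a : 'I_n.+1 -> {ffun 'I_n.+1 -> nat} -> bool) :
  (0 < k)%N ->
  (forall i (x : {ffun 'I_n.+1 -> nat}), x i = 0%N -> ~~ a i x) ->
  (forall i (x : {ffun 'I_n.+1 -> nat}), x i = k -> a i x) ->
  exists q : {ffun 'I_n.+1 -> 'I_k}, forall i, exists x y : {ffun 'I_n.+1 -> nat},
    [/\ (forall j, (q j <= x j <= (q j).+1)%N), (forall j, (q j <= y j <= (q j).+1)%N),
      ~~ a i x & a i y].
Proof.
move=> k0 a0 a1.
have F2 (u : 'F_2) : u + u = 0 by apply/val_inj; case: u => [[|[|]]].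
have [||q qa] := @kuhn _ n k F2 k0 (fun i x => (a i x)%:R).
- move=> i x; split => xi; first by rewrite (negbTE (a0 i x xi)).
  by rewrite a1.
- by move=> i x; case: (a i x); [right|left].
exists q => i; have [x [y [qx qy ax ay]]] := qa i; exists x, y; split=> //.
  by apply/negP => axT; move: ax; rewrite axT => /eqP; rewrite oner_eq0.
by move: ay; case: (a i y) => // /eqP; rewrite eq_sym oner_eq0.
Qed.

(** * The Poincare-Miranda theorem *)

Section poincare_miranda.
Context {R : realType}.

Lemma coord_le_norm n (x : 'rV[R]_n) i : `|x 0 i| <= `|x|.
Proof.
rewrite [leRHS]/Num.norm /= mx_normrE.
exact: (le_bigmax _ (fun j : 'I_1 * 'I_n => `|x j.1 j.2|) (0, i)).
Qed.

Lemma norm_le_coord n (x : 'rV[R]_n) r : 0 <= r -> (forall i, `|x 0 i| <= r) ->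
  `|x| <= r.
Proof.
move=> r0 xr; rewrite [leLHS]/Num.norm /= mx_normrE; apply/bigmax_leP; split=> //.
by move=> [i j] _ /=; rewrite ord1.
Qed.

Lemma norm_lt_coord n (x : 'rV[R]_n) r : 0 < r -> (forall i, `|x 0 i| < r) ->
  `|x| < r.
Proof.
move=> r0 xr; rewrite [ltLHS]/Num.norm /= mx_normrE; apply/bigmax_ltP; split=> //.
by move=> [i j] _ /=; rewrite ord1.
Qed.

Lemma compact_cube n (p : 'rV[R]_n) r : 0 < r -> compact [set x | `|p - x| <= r].
Proof.
move=> r0; apply: bounded_closed_compact; last first.
  by have := @closed_ball_closed _ _ p r; rewrite closed_ballE.
exists (`|p| + r); split; first exact: num_real.
move=> M prM x /= px; apply/ltW/(le_lt_trans _ prM).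
rewrite -[x](subrK p) addrC (le_trans (ler_normD _ _))// lerD2l.
by rewrite distrC.
Qed.

Lemma within_continuousE (T U : pseudoMetricType R) (A : set T) (f : T -> U) :
  {within A, continuous f} <-> forall x, A x -> forall e : R, 0 < e ->
    exists2 dl : R, 0 < dl & forall u, A u -> ball x dl u -> ball (f x) e (f u).
Proof.
split.
  move=> /subspace_continuousP cf x Ax e e0.
  have /(_ _ (nbhsx_ballx (f x) e e0)) := cf x Ax.
  rewrite /nbhs /= /within /= => /nbhs_ballP[dl dl0 H].
  by exists dl => // u Au /H; exact.
move=> H; apply/subspace_continuousP => x Ax V /nbhs_ballP[e e0 eV].
have [dl dl0 Hdl] := H x Ax e e0.
by apply/nbhs_ballP; exists dl => // u xu Au; apply: eV; exact: Hdl.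
Qed.

(** If [f] misses [p], compactness gives a mesh so fine that in each small cube some coordinate of
    [f - p] keeps a strict sign. Kuhn's lemma, applied to the signs at the grid points, yields a
    small cube where every coordinate takes both signs. *)
Lemma poincare_miranda_succ n (p : 'rV[R]_n.+1) (r : R) (f : 'rV[R]_n.+1 -> 'rV[R]_n.+1) :
  0 < r -> {within [set x | `|p - x| <= r], continuous f} ->
  (forall x, `|p - x| <= r -> `|x - f x| <= r) ->
  exists2 x, `|p - x| <= r & f x = p.
Proof.
move=> r0 /within_continuousE cf fr; apply: contrapT => nex.
pose Q := [set x | `|p - x| <= r].
(* The bad property, at mesh [2 r / k] around [x], which [compact_near_coveringP] makes uniform in
   [x]. *)
pose P (k : nat) x := exists i, forall u w, Q u -> Q w ->
  `|x - u| <= 2 * r / k%:R -> `|x - w| <= 2 * r / k%:R ->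
  ~ (f u 0 i <= p 0 i <= f w 0 i).
have /compact_near_coveringP/(_ _ \oo P) cQ := compact_cube (p := p) r0.
have near_bad x : Q x -> \forall x' \near x & k \near \oo, P k x'.
  move=> Qx; have /eqP/rowP fxp : f x != p by apply/eqP => fp; apply: nex; exists x.
  have [i /eqP fi] : exists i, f x 0 i <> p 0 i.
    by apply/existsNP => h; exact: fxp.
  pose e := `|f x 0 i - p 0 i|; have e0 : 0 < e by rewrite normr_gt0 subr_eq0.
  have [dl dl0 Hdl] := cf x Qx e e0.
  exists (ball x (dl / 2), [set k | 2 * r / k%:R < dl / 2]).
    split => /=; first by apply: nbhsx_ballx; rewrite divr_gt0.
    near=> k => /=; rewrite ltr_pdivrMr; last by rewrite ltr0n; near: k; exact: nbhs_infty_gt.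
    rewrite -ltr_pdivrMl ?divr_gt0//; near: k; exact: nbhs_infty_gtr.
  move=> [x' k] [/= xx' kd]; exists i => u w Qu Qw xu xw /andP[fu fw].
  have close z : Q z -> `|x' - z| <= 2 * r / k%:R -> `|f x 0 i - f z 0 i| < e.
    move=> Qz xz; have /(Hdl z Qz) : ball x dl z.
      rewrite [dl]splitr; apply: (ball_triangle xx').
      by rewrite -ball_normE /=; apply: le_lt_trans kd.
    rewrite -ball_normE /= => /(le_lt_trans _); apply.
    by have := coord_le_norm (f x - f z) i; rewrite !mxE.
  have := close _ Qu xu; have := close _ Qw xw; rewrite /e !ltr_norml.
  by case: (ltrP (f x 0 i) (p 0 i)) => h; rewrite ?(ltr0_norm, ger0_norm) ?subr_lt0 ?subr_ge0//;
   move=> /andP[? ?] /andP[? ?]; lra.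
have [k _ kP] := cQ _ near_bad.
(* [kP] holds from [k] on; the successor also makes the number of subdivisions positive. *)
pose m := k.+1; have m0 : 0 < m%:R :> R by rewrite ltr0n.
pose pt (x : {ffun 'I_n.+1 -> nat}) : 'rV[R]_n.+1 :=
  \row_i (p 0 i - r + 2 * r * (x i)%:R / m%:R).
have Qpt (x : {ffun 'I_n.+1 -> nat}) : (forall i, (x i <= m)%N) -> Q (pt x).
  move=> xm; apply: norm_le_coord; first exact: ltW.
  move=> i; rewrite !mxE.
  have x1 : (x i)%:R / m%:R <= 1 :> R by rewrite ler_pdivrMr// mul1r ler_nat.
  have x0 : 0 <= (x i)%:R / m%:R :> R by rewrite divr_ge0.
  rewrite ler_norml -mulrA; apply/andP; split; nra.
(* On the faces [fr] gives only the weak inequalities [f <= p] and [f >= p], so the label is imposed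
   there; the weak inequalities suffice for the contradiction. *)
pose a i (x : {ffun 'I_n.+1 -> nat}) := (x i == m) || ((x i != 0%N) && (p 0 i <= f (pt x) 0 i)).
have [||q qa] := @kuhn_bool n m a isT.
- by move=> i x xi; rewrite /a xi.
- by move=> i x xi; rewrite /a xi eqxx.
pose g := [ffun i => val (q i)] : {ffun 'I_n.+1 -> nat}.
have [|i Pi] := kP m (leqnSn k) (pt g).
  by apply: Qpt => i; rewrite ffunE; exact/ltnW/ltn_ord.
have [x [y [qx qy ax ay]]] := qa i.
have xm j : (x j <= m)%N by have /andP[_ /leq_trans] := qx j; apply; exact: ltn_ord.
have ym j : (y j <= m)%N by have /andP[_ /leq_trans] := qy j; apply; exact: ltn_ord.
have gx (z : {ffun 'I_n.+1 -> nat}) : (forall j, (q j <= z j <= (q j).+1)%N) ->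
    `|pt g - pt z| <= 2 * r / m%:R.
  move=> qz; apply: norm_le_coord; first by rewrite divr_ge0// mulr_ge0// ltW.
  move=> j; rewrite !mxE ffunE; have /andP[qz1 qz2] := qz j.
  have qz1' : `|(q j)%:R - (z j)%:R : R| <= 1.
    have -> : z j = (q j + (z j - q j))%N by lia.
    rewrite natrD opprD addrA subrr add0r normrN normr_nat.
    by rewrite -[leRHS]/(1%:R) ler_nat; lia.
  rewrite opprD addrACA subrr add0r -!mulrA -!mulrBr -mulrBl !normrM.
  rewrite (gtr0_norm r0) normfV !normr_nat !ler_pM2l//.
  by rewrite ler_piMl// invr_ge0 ltW.
apply: (Pi (pt x) (pt y)) => //; [exact: Qpt|exact: Qpt|exact: gx|exact: gx|].
have frx (z : {ffun 'I_n.+1 -> nat}) : (forall i, (z i <= m)%N) -> `|pt z 0 i - f (pt z) 0 i| <= r.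
  move=> /Qpt /fr; apply: le_trans.
  by have := coord_le_norm (pt z - f (pt z)) i; rewrite !mxE.
have := frx x xm; have := frx y ym; rewrite !ler_norml !mxE => /andP[y1 y2] /andP[x1 x2].
apply/andP; split.
  move: ax; rewrite /a negb_or negb_and negbK -ltNge => /andP[_ /orP[/eqP x0|/ltW//]].
  by move: x1 x2; rewrite x0; lra.
move: ay; rewrite /a => /orP[/eqP yi|/andP[]//].
by move: y1 y2; rewrite yi -mulrA divff ?gt_eqF// mulr1; lra.
Unshelve. all: by end_near. Qed.

Lemma poincare_miranda n (p : 'rV[R]_n) (r : R) (f : 'rV[R]_n -> 'rV[R]_n) :
  (0 < n)%N -> 0 < r -> {within [set x | `|p - x| <= r], continuous f} ->
  (forall x, `|p - x| <= r -> `|x - f x| <= r) ->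
  exists2 x, `|p - x| <= r & f x = p.
Proof. by case: n p f => // n p f _; exact: poincare_miranda_succ. Qed.

End poincare_miranda.

(** * Images under uniformly close homeomorphisms *)

Section homeomorphic_images.
Context {R : realType}.

Lemma limn_esup_le_near (u : (\bar R)^nat) (c : \bar R) :
  (\forall n \near \oo, (u n <= c)%E) -> (limn_esup u <= c)%E.
Proof.
move=> uc; rewrite /limn_esup limf_esupE.
apply: (@le_trans _ _ (ereal_sup (u @` [set n | (u n <= c)%E]))).
  by apply: ereal_inf_lbound; exists [set n | (u n <= c)%E].
by apply: ge_ereal_sup => _ [n /= unc <-].
Qed.

Lemma compact_cube_subset n (K V : set 'rV[R]_n) : compact K -> open V -> K `<=` V ->
  exists2 r : R, 0 < r & forall p x, K p -> `|p - x| <= r -> V x.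
Proof.
move=> cK oV KV.
pose P (r : R) (p : 'rV[R]_n) := forall x, `|p - x| <= r -> V x.
have /compact_near_coveringP/(_ _ 0^'+ P) cov := cK.
have loc p : K p -> \forall p' \near p & r \near 0^'+, P r p'.
  move=> /KV Vp; have /nbhs_ballP[e e0 eV] := open_nbhs_nbhs (conj oV Vp).
  exists (ball p (e / 2), [set r : R | r < e / 2]).
    split => /=; first by apply: nbhsx_ballx; rewrite divr_gt0.
    by apply: nbhs_right_lt; rewrite divr_gt0.
  move=> [p' r] [/= pp' re] x p'x; apply: eV; rewrite [e]splitr.
  apply: (ball_triangle pp'); rewrite -ball_normE /=; exact: le_lt_trans re.
have KP0 : \forall r \near (0 : R)^'+, K `<=` P r /\ 0 < r.
  by apply: filterI; [exact: cov|exact: nbhs_right_gt].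
have [r [KP r0]] := @filter_ex _ _ (at_right_proper_filter (0 : R)) _ KP0.
by exists r => // p x /KP; apply.
Qed.

Lemma uniform_near (T : choiceType) n (A : set T) (f : T -> 'rV[R]_n) (fn : nat -> T -> 'rV[R]_n) :
  {uniform A, fn @ \oo --> f} -> forall e : R, 0 < e ->
  \forall n \near \oo, forall x, A x -> `|f x - fn n x| < e.
Proof.
move=> fnf e e0.
have := fnf [set h | forall x, A x -> `|f x - h x| < e]; apply.
apply/uniform_nbhs.
exists [set xy | ball xy.1 e xy.2]; split; first exact: (entourage_ball _ (PosNum e0)).
by move=> h H x Ax; have := H x Ax; rewrite /= -ball_normE.
Qed.

Variable (d : nat).
Variables (A : set 'rV[R]_d) (y : 'rV[R]_d -> 'rV[R]_d)
  (yn : nat -> 'rV[R]_d -> 'rV[R]_d).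
Hypothesis yn_y : {uniform A, yn @ \oo --> y}.

Lemma image_subset_near (E U : set 'rV[R]_d) : compact (y @` E) -> open U ->
  y @` E `<=` U -> E `<=` A -> \forall n \near \oo, yn n @` E `<=` U.
Proof.
move=> cE oU EU EA; have [r r0 rU] := compact_cube_subset cE oU EU.
have := uniform_near yn_y r0; apply: filterS => n H _ [x Ex <-].
by apply: (rU (y x)); [exists x|apply/ltW/H/EA].
Qed.

Hypothesis d0 : (0 < d)%N.
Hypothesis y_homeo : homeomorphism_onto_image A y.
Hypothesis yn_cont : forall n, {within A, continuous (yn n)}.

Lemma compact_subset_image_near (O K : set 'rV[R]_d) : O `<=` A -> compact K ->
  K `<=` (y @` O)° -> \forall n \near \oo, K `<=` yn n @` O.
Proof.
move=> OA cK KO.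
(* One radius serves all points of [K], so the rank from which [n] works does not depend on [p]. *)
have [r r0 rV] := compact_cube_subset cK (@open_interior _ _) KO.
have [yc [h [/within_continuousE hc hy]]] := y_homeo.
have := uniform_near yn_y r0; apply: filterS => n H p Kp.
have cube x : `|p - x| <= r -> exists2 z, O z & x = y z.
  by move=> px; have /interior_subset[z Oz <-] := rV p x Kp px; exists z.
have [|x px|x px fx] := @poincare_miranda _ _ p r (yn n \o h) d0 r0.
- apply/within_continuousE => x px e e0.
  have [z Oz xz] := cube x px.
  have : {within A, continuous (yn n)} by exact: yn_cont.
  move=> /within_continuousE/(_ _ (OA _ Oz) _ e0)[e1 e10 H1].
  have Ax : (y @` A) x by exists z => //; exact: OA.
  have [dl dl0 H2] := hc _ Ax _ e10.
  exists dl => // u pu xu; have [w Ow uw] := cube u pu.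
  have Au : (y @` A) u by exists w => //; exact: OA.
  have := H2 _ Au xu; rewrite xz uw /= !hy//; [|exact: OA|exact: OA].
  by move=> /(H1 _ (OA _ Ow)).
- have [z Oz ->] := cube x px; rewrite /= hy; last exact: OA.
  by apply/ltW/H/OA.
- have [z Oz xz] := cube x px; exists z => //.
  by rewrite -fx xz /= hy//; exact: OA.
Qed.

End homeomorphic_images.

(** * The inequality for the capacity in the whole space *)

Lemma compact_image (R : realType) d (A E : set 'rV[R]_d) (f : 'rV[R]_d -> 'rV[R]_d) :
  {within A, continuous f} -> E `<=` A -> compact E -> compact (f @` E).
Proof.
move=> cf EA cE; apply: continuous_compact => //.
by apply: continuous_subspaceW cf.
Qed.

Lemma limn_esup_Cap_le (R : realType) d (A omega : set 'rV[R]_d)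
    (y : 'rV[R]_d -> 'rV[R]_d) (yn : nat -> 'rV[R]_d -> 'rV[R]_d) :
  {uniform A, yn @ \oo --> y} -> {within A, continuous y} ->
  compact omega -> omega `<=` A ->
  (limn_esup (fun n => Cap (yn n @` omega)) <= Cap (y @` omega))%E.
Proof.
move=> yn_y yc co oA; apply: le_ereal_inf_tmp => _ [v [g [vL vg gL [U [oU EU _ vU]] ->]]].
apply: limn_esup_le_near.
have cE := compact_image yc oA co.
have := image_subset_near yn_y cE oU EU oA; apply: filterS => n nU.
apply: ereal_inf_lbound; exists v, g; split=> //.
by exists U; split=> //; rewrite subsetT.
Qed.

(** * Lebesgue measure on R^d *)

Section borel_rV.
Context {R : realType} (n : nat).
Local Notation mu := (lebesgue_rV n : {sigma_finite_measure set 'rV[R]_n -> \bar R}).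

Lemma measurable_box (A : 'I_n -> set R) : (forall i, measurable (A i : set (measurableTypeR R))) ->
  measurable [set x : 'rV[R]_n | forall i, A i (x 0 i)].
Proof.
move=> mA; rewrite (_ : [set _ | _] =
  \bigcap_(i in setT) (fun x : 'rV[R]_n => x 0 i : measurableTypeR R) @^-1` A i).
  apply: fin_bigcap_measurable => // i _; rewrite -[X in measurable X]setTI.
  exact: measurable_coord.
by apply/seteqP; split => [x Ax i _|x Ax i]; exact: Ax.
Qed.

(** An open set is the union of the cubes with rational centre and radius that it contains; a cube
    that is not contained in [U] is replaced by the empty set. *)
Lemma measurable_open_rV (U : set 'rV[R]_n) : open U -> measurable U.
Proof.
move=> oU.
pose B (c : 'rV[rat]_n * rat) :=
  [set x : 'rV[R]_n | forall i, `|x 0 i - ratr (c.1 0 i)| < ratr c.2].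
pose C (c : 'rV[rat]_n * rat) := if `[< B c `<=` U >] then B c else set0.
have -> : U = \bigcup_c C c.
  apply/seteqP; split => [x Ux|x [c _]]; last first.
    by rewrite /C; case: asboolP => // cU; exact: cU.
  (* The rational radius is taken below [e / 2]: the centre is within it of [x], so the cube stays
     within [e] of [x]. *)
  have /nbhs_ballP[e /= e0 eU] := open_nbhs_nbhs (conj oU Ux).
  have [|q] := @rat_in_itvoo R 0 (e / 2); first by rewrite divr_gt0.
  rewrite in_itv /= => /andP[q0 qe].
  have /choice[c cx] : forall i, exists c : rat, `|x 0 i - ratr c| < ratr q.
    move=> i; have [|c] := @rat_in_itvoo R (x 0 i - ratr q) (x 0 i + ratr q); first by lra.
    rewrite in_itv /= => /andP[c1 c2]; exists c; rewrite ltr_norml; apply/andP; split; lra.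
  exists (\row_i c i, q) => //; rewrite /C; case: asboolP => [_ i|[]]; first by rewrite /= mxE.
  move=> z zB; apply: eU; rewrite -ball_normE /=; apply: norm_lt_coord => // i.
  rewrite !mxE; have := zB i; have := cx i; rewrite /= mxE !ltr_norml.
  by move=> /andP[? ?] /andP[? ?]; apply/andP; split; lra.
apply: countable_bigcupT_measurable => [|c]; first exact: countableP.
rewrite /C; case: asboolP => // _.
apply: measurable_box (fun i => [set t : R | `|t - ratr (c.1 0 i)| < ratr c.2]) _ => i.
rewrite (_ : mkset _ = `]ratr (c.1 0 i) - ratr c.2, ratr (c.1 0 i) + ratr c.2[%classic)//.
by apply/seteqP; split => t /=; rewrite in_itv /= ltr_norml => /andP[? ?]; apply/andP; split; lra.
Qed.

Lemma measurable_closed_rV (A : set 'rV[R]_n) : closed A -> measurable A.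
Proof.
by move=> cA; rewrite -[A]setCK; apply: measurableC;
  apply: measurable_open_rV; exact: closed_openC.
Qed.

Lemma measurable_compact_rV (A : set 'rV[R]_n) : compact A -> measurable A.
Proof. move=> cA; apply: measurable_closed_rV; apply: compact_closed cA.
exact: norm_hausdorff. Qed.

Lemma continuous_measurable_rV (f : 'rV[R]_n -> R) : continuous f ->
  measurable_fun [set: 'rV[R]_n] f.
Proof.
move=> /continuousP cf; apply: (measurability _ (RGenOpens.measurableE R)) => //.
move=> _ [_ [a [b ->] <-]]; rewrite setTI.
apply: measurable_open_rV; apply: cf; exact: interval_open.
Qed.

Lemma measurable_cube (M : R) : 0 < M -> measurable [set x : 'rV[R]_n | `|x| <= M].
Proof.
move=> M0; rewrite (_ : mkset _ = [set x | `|0 - x| <= M]).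
  by apply: measurable_compact_rV; exact: compact_cube.
by apply/seteqP; split => x /=; rewrite sub0r normrN.
Qed.

Lemma lebesgue_rV_cube_lty (M : R) : 0 < M -> (mu [set x | (`|x| <= M)%R] < +oo)%E.
Proof.
move=> M0; pose A (i : 'I_n) : set (measurableTypeR R) := `[- M, M]%classic.
have mA i : measurable (A i) by exact: measurable_itv.
apply: (@le_lt_trans _ _ (mu [set x | forall i, A i (x 0 i)])).
  apply: le_measure; rewrite ?inE.
  - exact: measurable_cube.
  - exact: measurable_box.
  - move=> x /= xM i; rewrite /A /= in_itv /= -ler_norml.
    exact: le_trans (coord_le_norm _ _) xM.
rewrite lebesgue_rV_box// ltey_eq prode_fin_num// => i _.
by rewrite /A lebesgue_measure_itv /=; case: ifP => _ //; rewrite -EFinB.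
Qed.

Lemma bounded_set_cube (A : set 'rV[R]_n) : bounded_set A ->
  exists2 M : R, 0 < M & A `<=` [set x | `|x| <= M].
Proof.
move=> [M [_ AM]]; exists (`|M| + 1); first by rewrite ltr_wpDl.
by move=> x Ax; apply: (AM (`|M| + 1)) => //; rewrite ltr_pwDr// ler_norm.
Qed.

Lemma lebesgue_rV_bounded_lty (A : set 'rV[R]_n) : measurable A -> bounded_set A ->
  (mu A < +oo)%E.
Proof.
move=> mA /bounded_set_cube[M M0 AM]; apply: le_lt_trans (lebesgue_rV_cube_lty M0).
by apply: le_measure; rewrite ?inE//; exact: measurable_cube.
Qed.

Lemma integrable_bounded_support (f : 'rV[R]_n -> R) (C M : R) :
  measurable_fun [set: 'rV[R]_n] f -> (forall x, `|f x| <= C) ->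
  (forall x, M < `|x| -> f x = 0) -> mu.-integrable setT (EFin \o f).
Proof.
move=> mf fC fM; pose M' := `|M| + 1; have M0 : 0 < M' by rewrite ltr_wpDl.
rewrite (_ : EFin \o f = (EFin \o f) \_ [set x : 'rV[R]_n | `|x| <= M']).
  apply/(integrable_mkcond _ (measurable_cube M0)).
  apply: measurable_bounded_integrable; first exact: measurable_cube.
  - exact: lebesgue_rV_cube_lty.
  - exact: measurable_funTS.
  - exists C; split; first exact: num_real.
    by move=> C' CC' x _ /=; apply: le_trans (ltW CC'); exact: fC.
apply/funext => x; rewrite patchE; case: ifPn => //; rewrite notin_setE /= => /negP.
rewrite -ltNge => xM; rewrite fM//; apply: le_lt_trans xM.
by rewrite (le_trans (ler_norm M))// lerDl.
Qed.

End borel_rV.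

(** * Integration by parts: integrals of partial derivatives *)

Section integral_partial.
Context {R : realType}.

Lemma continuous_support_bounded n (f : 'rV[R]_n -> R) (M : R) : continuous f ->
  (forall x, M < `|x| -> f x = 0) -> exists C : R, forall x, `|f x| <= C.
Proof.
move=> cf fM; pose M' := `|M| + 1; have M0 : 0 < M' by rewrite ltr_wpDl.
have := continuous_compact (continuous_subspaceT cf) (@compact_cube R n 0 M' M0).
move=> /compact_bounded [C [_ CP]]; exists (`|C| + 1) => x.
have CC : C < `|C| + 1 by rewrite ltr_pwDr// ler_norm.
have [xM|xM] := leP `|x| M'.
  by apply: (CP _ CC); exists x => //=; rewrite sub0r normrN.
rewrite fM ?normr0 ?addr_ge0//; apply: lt_trans xM.
by rewrite /M' ltr_pwDr// ler_norm.
Qed.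

Lemma integrable_continuous_support n (f : 'rV[R]_n -> R) (M : R) : continuous f ->
  (forall x, M < `|x| -> f x = 0) -> (lebesgue_rV n).-integrable setT (EFin \o f).
Proof.
move=> cf fM; have [C fC] := continuous_support_bounded cf fM.
exact: (integrable_bounded_support (continuous_measurable_rV cf) fC fM).
Qed.

Lemma consrV_shift0 n (t h : R) (x : 'rV[R]_n) :
  h *: delta_mx 0 ord0 + consrV (t, x) = consrV (h + t, x).
Proof.
apply/rowP => i; rewrite !mxE; case: (unliftP ord0 i) => [j|] -> /=.
  by rewrite mulr0 add0r.
by rewrite mulr1.
Qed.

Lemma consrV_shiftS n (t h : R) (x : 'rV[R]_n) j :
  h *: delta_mx 0 (lift ord0 j) + consrV (t, x) = consrV (t, h *: delta_mx 0 j + x).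
Proof.
apply/rowP => i; rewrite !mxE; case: (unliftP ord0 i) => [k|] -> /=.
  by rewrite !mxE (inj_eq (@lift_inj _ _)).
by rewrite mulr0 add0r.
Qed.

Lemma norm_consrV1 n (t : R) (x : 'rV[R]_n) : `|t| <= `|consrV (t, x)|.
Proof. by have := coord_le_norm (consrV (t, x)) ord0; rewrite mxE unlift_none. Qed.

Lemma norm_consrV2 n (t : R) (x : 'rV[R]_n) : `|x| <= `|consrV (t, x)|.
Proof.
apply: norm_le_coord => // i.
by have := coord_le_norm (consrV (t, x)) (lift ord0 i); rewrite mxE liftK.
Qed.

Lemma norm_consrVB n (t u : R) (x z : 'rV[R]_n) :
  `|consrV (t, x) - consrV (u, z)| <= Num.max `|t - u| `|x - z|.
Proof.
apply: norm_le_coord => [|i]; first by rewrite le_max normr_ge0.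
rewrite !mxE le_max; case: (unliftP ord0 i) => [k|] _ /=.
  by rewrite orbC; have := coord_le_norm (x - z) k; rewrite !mxE => ->.
by rewrite lexx.
Qed.

Lemma continuous_consrV n (f : 'rV[R]_n.+1 -> R) : continuous f ->
  (forall x, continuous (fun t => f (consrV (t, x)))) /\
  (forall t, continuous (fun x => f (consrV (t, x)))).
Proof.
move=> cf; split=> a b V /cf/nbhs_ballP[e /= e0 eV]; apply/nbhs_ballP; exists e => // u.
  rewrite -ball_normE /= => bu; apply: eV; rewrite -ball_normE /=.
  apply: le_lt_trans (norm_consrVB _ _ _ _) _.
  by rewrite gt_max bu subrr normr0.
rewrite -ball_normE /= => bu; apply: eV; rewrite -ball_normE /=.
apply: le_lt_trans (norm_consrVB _ _ _ _) _.
by rewrite gt_max bu subrr normr0 e0.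
Qed.

Lemma derivable_slice0 n (f : 'rV[R]_n.+1 -> R) (x : 'rV[R]_n) (t : R) :
  derivable f (consrV (t, x)) (delta_mx 0 ord0) ->
  is_derive t 1 (fun s : R => f (consrV (s, x))) (partial ord0 f (consrV (t, x))).
Proof.
move=> df; have e :
    (fun h : R => h^-1 *: (f (h *: delta_mx 0 ord0 + consrV (t, x)) - f (consrV (t, x)))) =
    (fun h : R => h^-1 *: (f (consrV (h *: 1 + t, x)) - f (consrV (t, x)))).
  by apply/funext => h; rewrite consrV_shift0 [h *: 1]mulr1.
split; first by rewrite /derivable -e.
by rewrite /partial /derive e.
Qed.

Lemma derivable_sliceS n (f : 'rV[R]_n.+1 -> R) (x : 'rV[R]_n) (t : R) j :
  derivable f (consrV (t, x)) (delta_mx 0 (lift ord0 j)) ->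
  is_derive x (delta_mx 0 j) (fun x => f (consrV (t, x))) (partial (lift ord0 j) f (consrV (t, x))).
Proof.
move=> df; have e :
    (fun h : R => h^-1 *:
      (f (h *: delta_mx 0 (lift ord0 j) + consrV (t, x)) - f (consrV (t, x)))) =
    (fun h : R => h^-1 *: (f (consrV (t, h *: delta_mx 0 j + x)) - f (consrV (t, x)))).
  by apply/funext => h; rewrite consrV_shiftS.
split; first by rewrite /derivable -e.
by rewrite /partial /derive e.
Qed.

Lemma partial_local0 n (f : 'rV[R]_n -> R) i (M : R) : (forall x, M < `|x| -> f x = 0) ->
  forall x, M < `|x| -> partial i f x = 0.
Proof.
move=> fM x xM; rewrite /partial (@near_eq_derive _ _ _ f (cst 0)) ?derive_cst//.
apply/nbhs_ballP; exists (`|x| - M) => /=; first by rewrite subr_gt0.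
move=> z; rewrite -ball_normE /= => xz; apply: fM.
have : `|x| <= `|x - z| + `|z| by rewrite -{1}[x](subrK z) ler_normD.
lra.
Qed.

(** Fubini splits off the first coordinate. If that is the direction of differentiation, the inner
    integral vanishes by the fundamental theorem of calculus; otherwise the induction hypothesis
    applies to each slice. *)
Lemma integral_partial n (i : 'I_n) (f : 'rV[R]_n -> R) (M : R) :
  (forall x, derivable f x (delta_mx 0 i)) -> continuous (partial i f) ->
  (forall x, M < `|x| -> f x = 0) ->
  (\int[lebesgue_rV n]_x (partial i f x)%:E = 0)%E.
Proof.
elim: n i f => [[]//|n IHn] i f df cf fM.
have dM := partial_local0 i fM.
have idf := integrable_continuous_support cf dM.
have mp : measurable_fun setT (EFin \o partial i f).
  by apply/measurable_EFinP; exact: continuous_measurable_rV.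
pose F := (EFin \o partial i f) \o @consrV R n.
have iF : @integrable _ (measurableTypeR R * 'rV[R]_n)%type R
    (lebesgue_measure \x lebesgue_rV n)%E setT F.
  apply/integrableP; split.
    apply: (measurableT_comp (f := EFin \o partial i f)); last exact: measurable_consrV.
    exact: mp.
  have /integrableP[_] := idf; rewrite /= /lebesgue_step ge0_integral_pushforward//.
  - exact: measurable_consrV.
  - exact: (measurableT_comp (f := abse) _ mp).
rewrite /= /lebesgue_step integral_pushforward//=; last exact: measurable_consrV.
rewrite preimage_setT.
suff: integral (product_measure1 lebesgue_measure (lebesgue_rV n)) setT F = 0%E by [].
have [cf1 cf2] := continuous_consrV cf.
case: (unliftP ord0 i) => [j|] ij; rewrite {}ij in df cf dM idf F iF cf1 cf2 *.
  rewrite -(integral12_prod_meas1 iF) integral0_eq// => t _.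
  have E x : partial j (fun x => f (consrV (t, x))) x = partial (lift ord0 j) f (consrV (t, x)).
    by have [_ <-] := derivable_sliceS (df (consrV (t, x))).
  transitivity (\int[lebesgue_rV n]_x (partial j (fun x => f (consrV (t, x))) x)%:E)%E.
    by apply: eq_integral => x _; rewrite E.
  apply: IHn => [x||x xM].
  - by have [] := derivable_sliceS (df (consrV (t, x))).
  - by rewrite (funext E).
  - by apply: fM; apply: lt_le_trans (norm_consrV2 _ _).
rewrite -(integral21_prod_meas1 iF) integral0_eq// => x _.
(* Strictly beyond [M], so that [f] vanishes at both endpoints of the interval. *)
pose M' : R := `|M| + 1; have M0 : 0 < M' by rewrite ltr_wpDl.
have MM : M < M' by rewrite /M' ltr_pwDr// ler_norm.
pose phi (t : R) : R := f (consrV (t, x)).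
have dphi (t : R) : is_derive t 1 phi (partial ord0 f (consrV (t, x))).
  exact: (derivable_slice0 (df (consrV (t, x)))).
have cphi : continuous phi.
  move=> t; apply/differentiable_continuous/derivable1_diffP; by have [] := dphi t.
transitivity (\int[lebesgue_measure]_(t in `[(- M')%R, M'%R])
  (partial ord0 f (consrV (t, x)))%:E)%E.
  rewrite [RHS]integral_mkcond; apply: eq_integral => t _; rewrite patchE.
  case: ifPn => //; rewrite notin_setE /= in_itv /= -ler_norml => /negP; rewrite -ltNge => tM.
  by rewrite /F /= dM//; apply: lt_le_trans (norm_consrV1 _ _); exact: lt_trans tM.
rewrite (@continuous_FTC2 _ _ phi); first last.
- by move=> t _; rewrite derive1E; have [_ ->] := dphi t.
- split; first by move=> t _; have [] := dphi t.
  + exact: cvg_at_right_filter (cphi _).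
  + exact: cvg_at_left_filter (cphi _).
- exact: continuous_subspaceT (cf1 x).
- by lra.
rewrite /phi !fM ?subee//.
all: apply: lt_le_trans (norm_consrV1 _ _); rewrite ?normrN gtr0_norm//.
Qed.

End integral_partial.

(** * Calculus of smooth functions *)

Section smooth_calculus.
Context {R : realType}.

(** Both sides have the same difference quotient. This gives the chain rule for directional
    derivatives from the one in one variable, without total differentiability of [f]. *)
Lemma is_derive_line (V W : normedModType R) (f : V -> W) x v a :
  is_derive x v f a <-> is_derive (0 : R) 1 (fun s : R => f (s *: v + x)) a.
Proof.
pose q1 := fun h : R => h^-1 *: (f (h *: v + x) - f x).
pose q2 := fun h : R =>
  h^-1 *: (f ((h *: (1 : R) + (0 : R)) *: v + x) - f ((0 : R) *: v + x)).
have e : q1 = q2.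
  rewrite /q1 /q2.
  by apply/funext => h; rewrite addr0 scale0r add0r [h *: 1]mulr1.
split=> -[df <-]; split.
- by change (cvg (q2 @ 0^')); rewrite -e.
- by change (lim (q2 @ 0^') = lim (q1 @ 0^')); rewrite e.
- by change (cvg (q1 @ 0^')); rewrite e.
- by change (lim (q1 @ 0^') = lim (q2 @ 0^')); rewrite e.
Qed.

Lemma is_derive_comp1 (V : normedModType R) (h : R -> R) (f : V -> R) x v a b :
  is_derive x v f a -> is_derive (f x) 1 h b -> is_derive x v (h \o f) (b * a).
Proof.
move=> /is_derive_line fa hb; apply/is_derive_line.
apply: (@is_derive1_comp _ h (fun s : R => f (s *: v + x))) => //.
by rewrite scale0r add0r.
Qed.

(** The class C^k for functions of one variable: the 1 counts variables, and [k] is the order. *)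
Fixpoint C1 k (h : R -> R) : Prop := continuous h /\
  if k is k'.+1 then (forall t : R, derivable h t 1) /\ C1 k' (fun t => 'D_1 h t) else True.

Lemma C1S k h h' : (forall t : R, is_derive t 1 h (h' t)) -> C1 k h' -> C1 k.+1 h.
Proof.
move=> dh ch; split.
  move=> t; apply/differentiable_continuous/derivable1_diffP; by have [] := dh t.
split; first by move=> t; have [] := dh t.
by rewrite (_ : (fun t => _) = h')//; apply/funext => t; have [_ ->] := dh t.
Qed.

Lemma C1D k g h : C1 k g -> C1 k h -> C1 k (fun t => g t + h t).
Proof.
elim: k g h => [|k IHk] g h [cg Dg] [ch Dh]; 
  first by split => // t; apply: cvgD; [exact: cg|exact: ch].
have [dg Cg] := Dg; have [dh Ch] := Dh.
apply: (C1S (h' := fun t => 'D_1 g t + 'D_1 h t)); last exact: IHk.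
by move=> t; apply: is_deriveD; exact: derivableP.
Qed.

Lemma C1Z k c h : C1 k h -> C1 k (fun t => c * h t).
Proof.
elim: k h => [|k IHk] h [ch Dh]; first by split => // t; apply: cvgM; [exact: cvg_cst|exact: ch].
have [dh Ch] := Dh.
apply: (C1S (h' := fun t => c * 'D_1 h t)); last exact: IHk.
by move=> t; apply: is_deriveZ; exact: derivableP.
Qed.

Definition smooth1 h := forall k, C1 k h.

Section several.
Variable d : nat.
Implicit Types f g : 'rV[R]_d -> R.

Fixpoint Ck k f : Prop := continuous f /\
  if k is k'.+1 then
    forall i, (forall x, derivable f x (delta_mx 0 i)) /\ Ck k' (partial i f)
  else True.

Lemma CkS k f (f' : 'I_d -> 'rV[R]_d -> R) : continuous f ->
  (forall i x, is_derive x (delta_mx 0 i) f (f' i x)) -> (forall i, Ck k (f' i)) -> Ck k.+1 f.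
Proof.
move=> cf df ch; split=> // i; split; first by move=> x; have [] := df i x.
by rewrite (_ : partial i f = f' i)//; apply/funext => t; have [_ <-] := df i t.
Qed.

Lemma CkW k f : Ck k.+1 f -> Ck k f.
Proof.
elim: k f => [|k IHk] f [cf Df]; split=> // i; have [df Cf] := Df i; split=> //.
exact: IHk.
Qed.

Lemma Ck_continuous k f : Ck k f -> forall x, {for x, continuous f}.
Proof. by case: k => [|k] []. Qed.

Lemma Ck_derivable k f i x : Ck k.+1 f -> is_derive x (delta_mx 0 i) f (partial i f x).
Proof. by move=> [_ /(_ i)[df _]]; exact: derivableP. Qed.

(** [smooth] applies further derivatives on the outside, whereas [Ck] peels off the innermost one,
    the form in which the Leibniz and chain rules allow induction. [foldr_rcons] translates between
    the two. *)
Lemma smoothP f : smooth f <-> forall k, Ck k f.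
Proof.
split=> [sf k|Cf s].
  elim: k f sf => [|k IHk] f sf; first by split=> //; have [] := sf [::].
  split; first by have [] := sf [::].
  move=> i; split; first by have [_] := sf [::].
  by apply: IHk => s; have := sf (rcons s i); rewrite foldr_rcons.
have H k : Ck k (foldr (@partial R d) f s).
  elim: s k => [|i s IHs] k //=; have [_ /(_ i)[]] := IHs k.+1; by [].
by split; [have [] := H 0|move=> i x; have [_ /(_ i)[]] := H 1].
Qed.

Lemma Ck_cst k c : Ck k (fun=> c).
Proof.
elim: k c => [|k IHk] c; first by split=> //; exact: cst_continuous.
apply: (CkS (f' := fun _ _ => 0)); [exact: cst_continuous|by move=> i; exact: IHk].
Qed.

Lemma CkD k f g : Ck k f -> Ck k g -> Ck k (fun x => f x + g x).
Proof.
elim: k f g => [|k IHk] f g Cf Cg.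
  by split=> // x; exact: (continuousD (@Ck_continuous _ _ Cf x) (@Ck_continuous _ _ Cg x)).
apply: (CkS (f' := fun i x => partial i f x + partial i g x)).
- by move=> x; exact: (continuousD (@Ck_continuous _ _ Cf x) (@Ck_continuous _ _ Cg x)).
- by move=> i x; exact: (is_deriveD (@Ck_derivable _ _ i x Cf) (@Ck_derivable _ _ i x Cg)).
- by move=> i; have [_ /(_ i)[_ ?]] := Cf; have [_ /(_ i)[_ ?]] := Cg; exact: IHk.
Qed.

Lemma CkM k f g : Ck k f -> Ck k g -> Ck k (fun x => f x * g x).
Proof.
elim: k f g => [|k IHk] f g Cf Cg.
  by split=> // x; exact: (continuousM (@Ck_continuous _ _ Cf x) (@Ck_continuous _ _ Cg x)).
apply: (CkS (f' := fun i x => f x * partial i g x + g x * partial i f x)).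
- by move=> x; exact: (continuousM (@Ck_continuous _ _ Cf x) (@Ck_continuous _ _ Cg x)).
- by move=> i x; exact: (is_deriveM (@Ck_derivable _ _ i x Cf) (@Ck_derivable _ _ i x Cg)).
- move=> i; have [_ /(_ i)[_ ?]] := Cf; have [_ /(_ i)[_ ?]] := Cg.
  by apply: CkD; apply: IHk => //; exact: CkW.
Qed.

Lemma Ck_comp k h f : C1 k h -> Ck k f -> Ck k (h \o f).
Proof.
elim: k h f => [|k IHk] h f [ch Dh] Cf.
  by split=> // x; exact: (continuous_comp (@Ck_continuous _ _ Cf x) (ch _)).
have [dh Ch] := Dh.
apply: (CkS (f' := fun i x => 'D_1 h (f x) * partial i f x)).
- by move=> x; exact: (continuous_comp (@Ck_continuous _ _ Cf x) (ch _)).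
- move=> i x; apply: (is_derive_comp1 (@Ck_derivable _ _ i x Cf)).
  by apply: derivableP; exact: dh.
- move=> i; have [_ /(_ i)[_ ?]] := Cf.
  by apply: CkM => //; apply: (IHk (fun t => 'D_1 h t)) => //; exact: CkW.
Qed.

Lemma is_derive_coord (i j : 'I_d) (x : 'rV[R]_d) :
  is_derive x (delta_mx 0 i) (fun x => x 0 j : R) (j == i)%:R.
Proof.
apply/is_derive_line.
pose c : R := (j == i)%:R.
rewrite (_ : (fun s : R => (s *: delta_mx 0 i + x) 0 j) = (fun s => s * c + x 0 j)); last first.
  by apply/funext => s; rewrite !mxE eqxx.
have := is_deriveD (is_deriveM (is_derive_id (0 : R) 1) (is_derive_cst c (0 : R) 1))
  (is_derive_cst (x 0 j) (0 : R) 1).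
by rewrite scaler0 add0r addr0 [_ *: 1]mulr1.
Qed.

Lemma Ck_coord k j : Ck k (fun x => x 0 j).
Proof.
case: k => [|k]; first by split=> //; exact: coord_continuous.
apply: (CkS (f' := fun i _ => (j == i)%:R)).
- exact: coord_continuous.
- by move=> i x; exact: is_derive_coord.
- by move=> i; exact: Ck_cst.
Qed.

Lemma smooth_cst c : smooth (fun _ : 'rV[R]_d => c).
Proof. by apply/smoothP => k; exact: Ck_cst. Qed.

Lemma smoothD f g : smooth f -> smooth g -> smooth (fun x => f x + g x).
Proof. by move=> /smoothP sf /smoothP sg; apply/smoothP => k; exact: CkD. Qed.

Lemma smoothM f g : smooth f -> smooth g -> smooth (fun x => f x * g x).
Proof. by move=> /smoothP sf /smoothP sg; apply/smoothP => k; exact: CkM. Qed.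

Lemma smooth_comp h f : smooth1 h -> smooth f -> smooth (h \o f).
Proof. by move=> sh /smoothP sf; apply/smoothP => k; exact: Ck_comp. Qed.

Lemma smooth_coord j : smooth (fun x : 'rV[R]_d => x 0 j).
Proof. by apply/smoothP => k; exact: Ck_coord. Qed.

Lemma smooth_prod (I : Type) (s : seq I) (F : I -> 'rV[R]_d -> R) :
  (forall i, smooth (F i)) -> smooth (fun x => \prod_(i <- s) F i x).
Proof.
move=> sF; elim: s => [|i s IHs].
  by rewrite (_ : (fun _ => _) = fun=> 1); [exact: smooth_cst|apply/funext => x; rewrite big_nil].
rewrite (_ : (fun _ => _) = fun x => F i x * \prod_(i <- s) F i x).
  exact: (smoothM (sF i) IHs).
by apply/funext => x; rewrite big_cons.
Qed.

Lemma smooth_continuous f : smooth f -> continuous f.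
Proof. by move=> /(_ [::])[]. Qed.

Lemma smooth_is_derive f i x : smooth f -> is_derive x (delta_mx 0 i) f (partial i f x).
Proof. by move=> /(_ [::])[_ /(_ i x)] df; exact: derivableP. Qed.

Lemma smooth_partial f i : smooth f -> smooth (partial i f).
Proof. by move=> sf s; have := sf (rcons s i); rewrite foldr_rcons. Qed.

Lemma partialD f g i x : smooth f -> smooth g ->
  partial i (fun x => f x + g x) x = partial i f x + partial i g x.
Proof.
by move=> sf sg; have [_] := is_deriveD (@smooth_is_derive _ i x sf) (@smooth_is_derive _ i x sg).
Qed.

Lemma partialM f g i x : smooth f -> smooth g ->
  partial i (fun x => f x * g x) x = f x * partial i g x + g x * partial i f x.
Proof.
by move=> sf sg; have [_] := is_deriveM (@smooth_is_derive _ i x sf) (@smooth_is_derive _ i x sg).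
Qed.

Lemma partial_cst c i (x : 'rV[R]_d) : partial i (fun=> c) x = 0.
Proof. exact: derive_cst. Qed.

Lemma partial_comp (h : R -> R) f i x : (forall t, derivable h t 1) -> smooth f ->
  partial i (h \o f) x = 'D_1 h (f x) * partial i f x.
Proof.
move=> dh sf; have hf := derivableP (dh (f x)).
by have [_] := is_derive_comp1 (@smooth_is_derive _ i x sf) hf.
Qed.

End several.
End smooth_calculus.

(** * Cutoff functions *)

Section special_functions.
Context {R : realType}.

(** The classical flat function [exp(-1/t)], with a factor [t^-k] so that derivatives remain linear
    combinations of members of the family. *)
Definition flat_exp (k : nat) (t : R) : R :=
  if 0 < t then t^-1 ^+ k * expR (- t^-1) else 0.

Lemma flat_exp0 k t : t <= 0 -> flat_exp k t = 0.
Proof. by move=> t0; rewrite /flat_exp ltNge t0. Qed.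

Lemma flat_exp_ge0 k t : 0 <= flat_exp k t.
Proof.
rewrite /flat_exp; case: ifP => // t0.
by rewrite mulr_ge0 ?expR_ge0// exprn_ge0// invr_ge0 ltW.
Qed.

Lemma flat_expS k t : t * flat_exp k.+1 t = flat_exp k t.
Proof.
rewrite /flat_exp; case: ifP => t0; last by rewrite mulr0.
by rewrite exprS !mulrA mulfV ?mul1r// gt_eqF.
Qed.

Lemma expR_ge_pow (m : nat) (s : R) : (0 < m)%N -> 0 <= s -> (s / m%:R) ^+ m <= expR s.
Proof.
move=> m0 s0; have mR : (m%:R : R) != 0 by rewrite pnatr_eq0 -lt0n.
have -> : expR s = expR (s / m%:R) ^+ m.
  by rewrite -expRM_natl mulrC divfK.
apply: lerXn2r; rewrite ?nnegrE ?expR_ge0 ?divr_ge0//.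
by apply: le_trans (expR_ge1Dx _); rewrite lerDr.
Qed.

(** With [s = 1/t], the exponential bound of order [k + 2] absorbs [t^-k] and leaves [t^2], enough
    for a zero derivative at the origin. *)
Lemma flat_exp_le_sqr k : exists2 C : R, 0 <= C & forall t, flat_exp k t <= C * t ^+ 2.
Proof.
pose m := k.+2; exists (m%:R ^+ m); first by rewrite exprn_ge0.
move=> t; rewrite /flat_exp; case: ifP => [t0|_]; last first.
  by rewrite mulr_ge0 ?sqr_ge0// exprn_ge0.
have s0 : 0 < t^-1 by rewrite invr_gt0.
have mR : 0 < m%:R :> R by rewrite ltr0n.
have := @expR_ge_pow m t^-1 isT (ltW s0).
rewrite expr_div_n => H.
have E : (t^-1) ^+ k = (t^-1) ^+ m * t ^+ 2.
  by rewrite /m -addn2 exprD -mulrA -exprMn mulVf ?gt_eqF// expr1n mulr1.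
rewrite E mulrAC ler_wpM2r ?sqr_ge0// expRN ler_pdivrMr ?expR_gt0//.
by rewrite -ler_pdivrMl ?exprn_gt0// mulrC.
Qed.

Lemma is_derive_sqr_bound (f : R -> R) (C : R) : (forall t, `|f t| <= C * t ^+ 2) ->
  is_derive (0 : R) 1 f 0.
Proof.
move=> fC; have f0 : f 0 = 0.
  by apply/eqP; rewrite -normr_le0 (le_trans (fC 0))// expr0n /= mulr0.
have C0 : 0 <= C by have := fC 1; rewrite expr1n mulr1; exact: le_trans.
have lim0 : (fun h : R => h^-1 *: (f (h *: 1 + 0) - f 0)) @ 0^' --> (0 : R).
  apply/cvgrPdist_lt => e e0; near=> h.
  have h0 : h != 0 by near: h; exact: nbhs_dnbhs_neq.
  have hp : 0 < `|h| by rewrite normr_gt0.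
  rewrite sub0r normrN f0 subr0 addr0 [h *: 1]mulr1 normrM normfV ltr_pdivrMl//.
  apply: le_lt_trans (fC h) _.
  rewrite -real_normK ?num_real// expr2 mulrA mulrC ltr_pM2l//.
  have : `|h| < e / (C + 1).
    near: h; apply: dnbhs0_lt; rewrite divr_gt0// ltr_wpDl//.
  rewrite ltr_pdivlMr ?ltr_wpDl// => hC; apply: le_lt_trans hC.
  by rewrite mulrC ler_pM2l// lerDl.
split; first by apply/cvg_ex; exists 0.
exact/cvg_lim.
Unshelve. all: by end_near. Qed.

Lemma is_derive_flat_exp k (t : R) :
  is_derive t 1 (flat_exp k) (flat_exp k.+2 t - k%:R * flat_exp k.+1 t).
Proof.
have [t0|t0|->] := ltgtP t 0.
- rewrite !flat_exp0 ?(ltW t0)// mulr0 subr0.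
  apply: (near_eq_is_derive (f := cst 0)).
  near=> s; rewrite flat_exp0//; apply: ltW; near: s; exact: lt_nbhsl.
- have tn : t != 0 by rewrite gt_eqF.
  have dV := is_deriveV tn (is_derive_id t 1).
  have dE := is_derive1_comp (is_derive_expR _) (is_deriveN dV).
  have dM := is_deriveM (is_deriveX k dV) dE.
  have H : is_derive t 1 (fun s => s^-1 ^+ k * expR (- s^-1))
      (flat_exp k.+2 t - k%:R * flat_exp k.+1 t).
    have -> : (fun s : R => s^-1 ^+ k * expR (- s^-1)) =
        (fun s => s^-1) ^+ k * (expR \o - (fun s : R => s^-1)).
      by apply/funext => s; rewrite !fctE.
    apply: is_derive_eq dM _; rewrite /flat_exp t0 /= /GRing.scale /= !mulr1.
    rewrite !fctE opprK -exprVn; case: k => [|k] /=; rewrite !exprS ?expr0; ring.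
  apply: near_eq_is_derive H.
  near=> s; rewrite /flat_exp ifT//; near: s; exact: lt_nbhsr.
- rewrite !flat_exp0// mulr0 subr0.
  have [C _ HC] := flat_exp_le_sqr k.
  apply: (@is_derive_sqr_bound _ C) => u.
  by rewrite ger0_norm ?flat_exp_ge0.
Unshelve. all: by end_near. Qed.

Lemma smooth1_flat_exp k : smooth1 (flat_exp k).
Proof.
move=> m; elim: m k => [|m IHm] k.
  split=> // t; apply/differentiable_continuous/derivable1_diffP.
  by have [] := is_derive_flat_exp k t.
apply: (C1S (is_derive_flat_exp k)); apply: C1D => //.
rewrite (_ : (fun t => _) = (fun t => - k%:R * flat_exp k.+1 t)); first exact: C1Z.
by apply/funext => t; rewrite mulNr.
Qed.

(* t e^(-1/t) for t > 0: its derivative (1 + 1/t) e^(-1/t) is at most 1 because 1 + s <= e^s. *)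
Definition ramp (t : R) : R := t * flat_exp 0 t.

Lemma is_derive_ramp (t : R) : is_derive t 1 ramp (flat_exp 0 t + flat_exp 1 t).
Proof.
have := is_deriveM (is_derive_id t 1) (is_derive_flat_exp 0 t).
rewrite mul0r subr0 => H; apply: is_derive_eq H _.
by rewrite /GRing.scale /= mulr1 flat_expS addrC.
Qed.

Lemma smooth1_ramp : smooth1 ramp.
Proof.
case=> [|k]; last by apply: (C1S is_derive_ramp); apply: C1D; exact: smooth1_flat_exp.
split=> // t; apply/differentiable_continuous/derivable1_diffP.
by have [] := is_derive_ramp t.
Qed.

Lemma ramp0 t : t <= 0 -> ramp t = 0.
Proof. by move=> t0; rewrite /ramp flat_exp0// mulr0. Qed.

(** The upper bound is [exp(-1/t) >= 1 - 1/t] multiplied by [t]. *)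
Lemma ramp_dist t : 0 <= t -> 0 <= t - ramp t <= 1.
Proof.
rewrite le_eqVlt => /predU1P[<-|t0]; first by rewrite ramp0// subr0 lexx ler01.
rewrite /ramp /flat_exp t0 expr0 mul1r.
have := expR_ge1Dx (- t^-1); have := expR_gt0 (- t^-1) => e0 e1.
have e2 : expR (- t^-1) <= 1 by rewrite -expR0 ler_expR oppr_le0 invr_ge0 ltW.
have tV : t * t^-1 = 1 by rewrite mulfV ?gt_eqF.
apply/andP; split; nra.
Qed.

Lemma ramp_derive_bound t : 0 <= flat_exp 0 t + flat_exp 1 t <= 1.
Proof.
rewrite addr_ge0 ?flat_exp_ge0//= /flat_exp; case: ifP => t0; last by rewrite addr0 ler01.
rewrite expr0 expr1 -mulrDl expRN ler_pdivrMr ?expR_gt0// mul1r.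
exact: expR_ge1Dx.
Qed.

End special_functions.

Section cutoffs.
Context {R : realType}.

Lemma flat_exp_mono : {homo @flat_exp R 0 : s t / s <= t}.
Proof.
move=> s t st; have [s0|s0] := leP s 0; first by rewrite flat_exp0// flat_exp_ge0.
have t0 := lt_le_trans s0 st.
by rewrite /flat_exp s0 t0 !expr0 !mul1r ler_expR lerN2 lef_pV2 ?posrE.
Qed.

Lemma flat_exp_gt0 k (t : R) : 0 < t -> 0 < flat_exp k t.
Proof.
by move=> t0; rewrite /flat_exp t0 mulr_gt0 ?expR_gt0// exprn_gt0// invr_gt0.
Qed.

(* The inner [flat_exp 0] vanishes for [1 <= t] and exceeds [flat_exp 0 1] for [t <= 0]. *)
Definition step (t : R) : R :=
  (flat_exp 0 (flat_exp 0 1))^-1 * flat_exp 0 (flat_exp 0 1 + -1 * flat_exp 0 (1 + -1 * t)).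

Lemma step1 t : 1 <= t -> step t = 1.
Proof.
move=> t1; rewrite /step [flat_exp 0 (1 + _)]flat_exp0; last by lra.
by rewrite mulr0 addr0 mulVf// gt_eqF// !flat_exp_gt0.
Qed.

Lemma step0 t : t <= 0 -> step t = 0.
Proof.
move=> t0; rewrite /step [flat_exp 0 (_ + _)]flat_exp0 ?mulr0//.
have : flat_exp 0 (1 : R) <= flat_exp 0 (1 + -1 * t) by apply: flat_exp_mono; lra.
lra.
Qed.

Lemma step_bound t : 0 <= step t <= 1.
Proof.
have p : 0 < flat_exp 0 (flat_exp 0 (1 : R)) by rewrite !flat_exp_gt0.
rewrite /step mulr_ge0 ?invr_ge0 ?flat_exp_ge0//= mulrC ler_pdivrMr// mul1r.
by apply: flat_exp_mono; rewrite gerDl mulN1r oppr_le0 flat_exp_ge0.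
Qed.

Lemma mulr_in01 (a b : R) : 0 <= a <= 1 -> 0 <= b <= 1 -> 0 <= a * b <= 1.
Proof.
by move=> /andP[a0 a1] /andP[b0 b1]; rewrite mulr_ge0//= mulr_ile1.
Qed.

Lemma prod_in01 (I : Type) (s : seq I) (F : I -> R) :
  (forall i, 0 <= F i <= 1) -> 0 <= \prod_(i <- s) F i <= 1.
Proof.
move=> F01; elim/big_ind : _ => [||i _]; last exact: F01.
  by rewrite ler01 lexx.
exact: mulr_in01.
Qed.

Section cutoff.
Variable d : nat.
Implicit Types (p x : 'rV[R]_d) (f u : 'rV[R]_d -> R).

Lemma smooth_affine (a b : R) f : smooth f -> smooth (fun x => a + b * f x).
Proof.
by move=> sf; exact: (smoothD (smooth_cst a) (smoothM (smooth_cst b) sf)).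
Qed.

Lemma smooth_step u : smooth u -> smooth (step \o u).
Proof.
move=> su; have H a b f : smooth f -> smooth (fun x => flat_exp 0 (a + b * f x)).
  by move=> sf; apply: (smooth_comp (smooth1_flat_exp 0)); exact: smooth_affine.
apply: smoothM; first exact: smooth_cst.
exact/H/H.
Qed.

(** A cutoff for sup-norm cubes: as [|x_i - p_i|] grows from [r] to [2 r], one of the arguments
    [2 + (p_i - x_i)/r], [2 - (p_i - x_i)/r] falls from 1 to 0. *)
Definition plateau p (r : R) x : R :=
  \prod_i (step (2 + r^-1 * p 0 i + - r^-1 * x 0 i) * step (2 - r^-1 * p 0 i + r^-1 * x 0 i)).

Lemma smooth_plateau p r : smooth (plateau p r).
Proof.
apply: smooth_prod => i; apply: smoothM.
  by apply: smooth_step; apply: smooth_affine; exact: smooth_coord.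
by apply: smooth_step; apply: smooth_affine; exact: smooth_coord.
Qed.

Lemma plateau_bound p r x : 0 <= plateau p r x <= 1.
Proof.
apply: prod_in01 => i; apply: mulr_in01; exact: step_bound.
Qed.

Lemma plateau1 p r x : 0 < r -> `|p - x| <= r -> plateau p r x = 1.
Proof.
move=> r0 px; rewrite /plateau big1// => i _.
have : `|r^-1 * p 0 i - r^-1 * x 0 i| <= 1.
  rewrite -mulrBr normrM normfV (gtr0_norm r0) mulrC ler_pdivrMr// mul1r.
  by have := coord_le_norm (p - x) i; rewrite !mxE => /le_trans; apply.
rewrite ler_norml => /andP[? ?].
by rewrite !step1 ?mulr1//; lra.
Qed.

Lemma plateau0 p r x : 0 < r -> r * 2 <= `|p - x| -> plateau p r x = 0.
Proof.
move=> r0; apply: contraTeq => px; rewrite -ltNge; apply: norm_lt_coord => [|i].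
  by rewrite mulr_gt0.
rewrite !mxE ltNge; apply: contra px => px.
have H : 2 <= `|r^-1 * p 0 i - r^-1 * x 0 i|.
  by rewrite -mulrBr normrM normfV (gtr0_norm r0) mulrC ler_pdivlMr// mulrC.
rewrite /plateau (bigD1 i)//= mulf_eq0; apply/orP; left.
move: H; rewrite ler_normr => /orP[] H.
  by rewrite [X in _ * X]step0 ?mulr0//; lra.
by rewrite [X in X * _]step0 ?mul0r//; lra.
Qed.

(** [E] is covered by finitely many balls of radius [s], and [eta] is 1 minus the product of the
    [1 - plateau]: it is 1 where some plateau is 1, and 0 where all vanish. Since [2 s = r], its
    support stays in the cubes of radius [r], which lie in [U]. *)
Lemma cutoff_exists (E U : set 'rV[R]_d) : compact E -> open U -> E `<=` U ->
  exists eta : 'rV[R]_d -> R, exists K V : set 'rV[R]_d,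
  [/\ smooth eta, (forall x, 0 <= eta x <= 1), compact K /\ K `<=` U,
      (forall x, ~ K x -> eta x = 0) &
      [/\ open V, E `<=` V, V `<=` K & forall x, V x -> eta x = 1]].
Proof.
move=> cE oU EU; have [r r0 rU] := compact_cube_subset cE oU EU.
pose s := r / 2; have s0 : 0 < s by rewrite divr_gt0.
have [D DE covD] : finite_subset_cover E (fun p => ball p s) E.
  move: cE; rewrite compact_cover => /(_ _ E (fun p => ball p s)); apply.
    by move=> p _; exact: ball_open.
  by move=> p Ep; exists p => //; exact: ballxx.
exists (fun x => 1 + -1 * \prod_(p <- enum_fset D) (1 + -1 * plateau p s x)).
exists (\big[setU/set0]_(p <- enum_fset D) [set x | `|p - x| <= r]).
exists (\bigcup_(p in [set` D]) ball p s).
split.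
- apply: smooth_affine; apply: smooth_prod => p; apply: smooth_affine.
  exact: smooth_plateau.
- move=> x; have /andP[a b] : 0 <= \prod_(p <- enum_fset D) (1 + -1 * plateau p s x) <= 1.
    apply: (@prod_in01 _ _ (fun p => 1 + -1 * plateau p s x)) => p.
    by have /andP[? ?] := plateau_bound p s x; apply/andP; split; lra.
  by apply/andP; split; lra.
- split; first by apply: (bigsetU_compact (F := fun p => [set x | `|p - x| <= r])) => p _;
    exact: compact_cube.
  rewrite -bigcup_seq => x [p /= pD px]; apply: (rU p) => //.
  exact: (set_mem (DE p pD)).
- move=> x; rewrite -bigcup_seq => Kx.
  rewrite big_seq big1 ?mulr1 ?subrr// => p pD.
  rewrite plateau0 ?mulr0 ?addr0// /s divfK//.
  by rewrite leNgt; apply/negP => px; apply: Kx; exists p => //; exact: ltW.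
- split => //.
  + by apply: bigcup_open => p _; exact: ball_open.
  + move=> x [p pD px]; rewrite -bigcup_seq; exists p => //=.
    move: px; rewrite -ball_normE /= => /ltW /le_trans; apply.
    by rewrite /s; lra.
  + move=> x [p pD px]; rewrite (big_rem p)//= plateau1//; first lra.
    by move: px; rewrite -ball_normE /= => /ltW.
Qed.

(** [psi = e (ramp(f/e - 1) - ramp(-f/e - 1))]. The bound [2 e] is [e] for the shift plus [e] for
    the gap between [ramp] and the identity; [th] is the derivative of the ramp that is active. *)
Lemma soft_threshold f (e : R) : 0 < e -> smooth f -> exists psi,
  [/\ smooth psi, (forall x, `|f x| <= e -> psi x = 0),
      (forall x, `|f x - psi x| <= 2 * e) &
      forall x, exists2 th, 0 <= th <= 1 & forall i, partial i psi x = th * partial i f x].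
Proof.
move=> e0 sf.
pose u x := -1 + e^-1 * f x; pose w x := -1 + - e^-1 * f x.
have su : smooth u by exact: smooth_affine.
have sw : smooth w by exact: smooth_affine.
pose ru x := ramp (u x); pose rw x := ramp (w x).
have sru : smooth ru by exact: (smooth_comp (@smooth1_ramp R)).
have srw : smooth rw by exact: (smooth_comp (@smooth1_ramp R)).
exists (fun x => e * (ru x + -1 * rw x)); split.
- exact: (smoothM (smooth_cst e) (smoothD sru (smoothM (smooth_cst (-1)) srw))).
- move=> x fx; have : `|e^-1 * f x| <= 1.
    by rewrite normrM normfV (gtr0_norm e0) mulrC ler_pdivrMr// mul1r.
  rewrite ler_norml => /andP[a b].
  by rewrite /ru /rw /u /w !ramp0 ?mulr0 ?addr0 ?mulr0//; lra.
- move=> x; pose s := e^-1 * f x.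
  have -> : f x = e * s by rewrite /s mulrA mulfV ?mul1r// gt_eqF.
  rewrite -mulrBr normrM (gtr0_norm e0) mulrC ler_pM2r//.
  rewrite /ru /rw /u /w [- e^-1 * _]mulNr -/s.
  have [s1|s1] := leP 1 s.
    have /ramp_dist/andP[] : 0 <= -1 + s by lra.
    by rewrite [ramp (_ - s)]ramp0; [rewrite ler_norml => ? ?; apply/andP; split; lra|lra].
  have [s2|s2] := leP s (-1).
    have /ramp_dist/andP[] : 0 <= -1 - s by lra.
    by rewrite [ramp (_ + s)]ramp0; [rewrite ler_norml => ? ?; apply/andP; split; lra|lra].
  by rewrite !ramp0; [rewrite ler_norml; apply/andP; split; lra|lra|lra].
- move=> x; pose q t : R := flat_exp 0 t + flat_exp 1 t.
  exists (q (u x) + q (w x)).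
    have /andP[a b] := ramp_derive_bound (u x); have /andP[a' b'] := ramp_derive_bound (w x).
    rewrite addr_ge0//=.
    (* Since [u + w = -2], at most one of the two ramps has a nonzero slope. *)
    have [u0|u0] := leP (u x) 0.
      by rewrite /q (flat_exp0 0 u0) (flat_exp0 1 u0) !add0r.
    have w0 : w x <= 0 by move: u0; rewrite /u /w; lra.
    by rewrite /q (flat_exp0 0 w0) (flat_exp0 1 w0) !addr0.
  move=> i.
  have dr t : derivable (@ramp R) t 1 by have [] := is_derive_ramp t.
  have Dr t : 'D_1 (@ramp R) t = q t by have [_ ->] := is_derive_ramp t.
  have pZ b h : smooth h -> partial i (fun x => b * h x) x = b * partial i h x.
    by move=> sh; rewrite (partialM i x (smooth_cst b) sh) partial_cst mulr0 addr0.
  have pa a b : partial i (fun x => a + b * f x) x = b * partial i f x.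
    rewrite (partialD i x (smooth_cst a) (smoothM (smooth_cst b) sf)) partial_cst add0r.
    exact: pZ.
  have s1 := smoothM (smooth_cst (-1)) srw.
  rewrite (pZ _ _ (smoothD sru s1)) (partialD i x sru s1) (pZ _ _ srw).
  rewrite (partial_comp i x dr su) (partial_comp i x dr sw) !Dr !pa.
  have en : e != 0 by rewrite gt_eqF.
  by field.
Qed.

End cutoff.
End cutoffs.

(** * Square integrable functions *)

Section square_integrable.
Context d (T : measurableType d) (R : realType) (mu : {measure set T -> \bar R}).
Implicit Types f g h m : T -> R.

Lemma integral_lin2 f g (a b : R) : 0 <= a -> 0 <= b ->
  (forall x, 0 <= f x) -> (forall x, 0 <= g x) ->
  measurable_fun [set: T] f -> measurable_fun [set: T] g ->
  (\int[mu]_x (a * f x + b * g x)%:E =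
   a%:E * \int[mu]_x (f x)%:E + b%:E * \int[mu]_x (g x)%:E)%E.
Proof.
move=> a0 b0 f0 g0 mf mg.
under eq_integral do rewrite EFinD !EFinM.
rewrite ge0_integralD//.
- rewrite !ge0_integralZl_EFin//; first [by move=> x _; rewrite lee_fin | exact/measurable_EFinP].
- by move=> x _; rewrite -EFinM lee_fin mulr_ge0.
- by apply/measurable_EFinP; exact: measurable_funM.
- by move=> x _; rewrite -EFinM lee_fin mulr_ge0.
- by apply/measurable_EFinP; exact: measurable_funM.
Qed.

Lemma le_integral_ge0 f g : (forall x, 0 <= f x) -> (forall x, f x <= g x) ->
  measurable_fun [set: T] f -> measurable_fun [set: T] g ->
  (\int[mu]_x (f x)%:E <= \int[mu]_x (g x)%:E)%E.
Proof.
move=> f0 fg mf mg; apply: ge0_le_integral => //.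
- by move=> x _; rewrite lee_fin.
- exact/measurable_EFinP.
- exact/measurable_EFinP.
- by move=> x _; rewrite lee_fin.
Qed.

Definition L2 f := measurable_fun [set: T] f /\ (\int[mu]_x (f x ^+ 2)%:E < +oo)%E.

Lemma L2P f : f \in Lfun mu 2%:E <-> L2 f.
Proof.
split=> [fL|[mf fi]].
  have /integrableP[_] := Lfun2_integrable_sqr fL.
  have mf : measurable_fun [set: T] f by exact: (set_mem (sub_Lfun_mfun fL)).
  move=> H; split=> //.
  apply: le_lt_trans H; apply: ge0_le_integral => //.
  - by move=> x _; rewrite lee_fin sqr_ge0.
  - by apply/measurable_EFinP; exact: measurable_funX.
  - apply: (measurableT_comp (f := abse)) => //.
    by apply/measurable_EFinP; exact: measurable_funX.
  - by move=> x _ /=; rewrite lee_fin ler_norm.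
apply/andP; split; apply/mem_set => //=.
rewrite /finite_norm unlock /= poweR_lty//.
apply: le_lt_trans fi; apply: ge0_le_integral => //.
- apply/measurable_EFinP.
  apply/(@measurableT_comp _ _ _ _ _ _ (fun x : R => x `^ 2)%R) => //.
  exact/measurableT_comp.
- by apply/measurable_EFinP; exact: measurable_funX.
- by move=> x _ /=; rewrite lee_fin powR_mulrn// real_normK// num_real.
Qed.

Lemma measurable_sqr f : measurable_fun [set: T] f -> measurable_fun [set: T] (fun x => f x ^+ 2).
Proof. exact: measurable_funX. Qed.

Lemma integral_sqr_le f g h (a b : R) : 0 <= a -> 0 <= b ->
  measurable_fun [set: T] f -> measurable_fun [set: T] g -> measurable_fun [set: T] h ->
  (forall x, h x ^+ 2 <= a * f x ^+ 2 + b * g x ^+ 2) ->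
  (\int[mu]_x (h x ^+ 2)%:E <=
   a%:E * \int[mu]_x (f x ^+ 2)%:E + b%:E * \int[mu]_x (g x ^+ 2)%:E)%E.
Proof.
move=> a0 b0 mf mg mh hfg.
rewrite -integral_lin2 => //; try exact: measurable_sqr; try by move=> x; exact: sqr_ge0.
apply: le_integral_ge0 => //; [by move=> x; exact: sqr_ge0|exact: measurable_sqr|].
by apply: measurable_funD; apply: measurable_funM => //; exact: measurable_sqr.
Qed.

Lemma L2_le f g h (a b : R) : 0 <= a -> 0 <= b -> L2 f -> L2 g ->
  measurable_fun [set: T] h -> (forall x, h x ^+ 2 <= a * f x ^+ 2 + b * g x ^+ 2) -> L2 h.
Proof.
move=> a0 b0 [mf fi] [mg gi] mh hfg; split=> //.
apply: le_lt_trans (integral_sqr_le a0 b0 mf mg mh hfg) _.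
rewrite lte_add_pinfty// lte_mul_pinfty//.
Qed.

Lemma L2D f g : L2 f -> L2 g -> L2 (fun x => f x + g x).
Proof.
move=> fL gL; have [mf _] := fL; have [mg _] := gL.
apply: (L2_le (a := 2) (b := 2) _ _ fL gL) => //; first exact: measurable_funD.
by move=> x; have := sqr_ge0 (f x - g x); rewrite !expr2; lra.
Qed.

Lemma L2_bounded f m (C : R) : L2 f -> measurable_fun [set: T] m ->
  (forall x, `|m x| <= C) -> L2 (fun x => m x * f x).
Proof.
move=> fL mm mC; have [mf _] := fL.
apply: (L2_le (a := C ^+ 2) (b := 0) _ _ fL fL) => //; rewrite ?sqr_ge0//.
  exact: measurable_funM.
move=> x; rewrite mul0r addr0 exprMn ler_wpM2r ?sqr_ge0//.
by rewrite -[m x ^+ 2]real_normK ?num_real// lerXn2r ?nnegrE// (le_trans _ (mC x)).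
Qed.

Lemma L2_integrableM f g : L2 f -> L2 g -> mu.-integrable setT (EFin \o (fun x => f x * g x)).
Proof. by move=> /L2P fL /L2P gL; apply/Lfun1_integrable; exact: Lfun2_mul_Lfun1. Qed.

Lemma integral_restrictM (D : set T) f m :
  (\int[mu]_(x in D) (f x * m x)%:E = \int[mu]_x ((f \_ D) x * m x)%:E)%E.
Proof.
rewrite integral_mkcond; apply: eq_integral => x _.
by rewrite !patchE; case: ifP => // _; rewrite mul0r.
Qed.

End square_integrable.

(** * Sobolev functions extended by zero *)

Section sobolev_tools.
Context {R : realType} (d : nat).
Implicit Types (D K U : set 'rV[R]_d) (v f phi : 'rV[R]_d -> R) (g : 'rV[R]_d -> 'rV[R]_d).
Local Notation mu := (lebesgue_rV d : {sigma_finite_measure set 'rV[R]_d -> \bar R}).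

Lemma partial_vanish K f i : closed K -> (forall x, ~ K x -> f x = 0) ->
  forall x, ~ K x -> partial i f x = 0.
Proof.
move=> cK fK x nKx; rewrite /partial (@near_eq_derive _ _ _ f (cst 0)) ?derive_cst//.
have oK : open (~` K) by exact: closed_openC.
exact: (filterS fK (open_nbhs_nbhs (conj oK nKx))).
Qed.

Lemma compact_closed_rV K : compact K -> closed K.
Proof. by apply: compact_closed; exact: norm_hausdorff. Qed.

Lemma compact_vanish_far K f : compact K -> (forall x, ~ K x -> f x = 0) ->
  exists M : R, forall x, M < `|x| -> f x = 0.
Proof.
move=> cK fK; have [M _ KM] := bounded_set_cube (compact_bounded cK).
by exists M => x xM; apply: fK => /KM /=; rewrite leNgt xM.
Qed.

Lemma bounded_compact_support K f : continuous f -> compact K -> (forall x, ~ K x -> f x = 0) ->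
  exists2 C : R, 0 <= C & forall x, `|f x| <= C.
Proof.
move=> cf cK fK; have [M fM] := compact_vanish_far cK fK.
have [C fC] := continuous_support_bounded cf fM.
by exists C => //; exact: le_trans (fC 0).
Qed.

Lemma L2_compact_support K f : continuous f -> compact K -> (forall x, ~ K x -> f x = 0) ->
  L2 mu f.
Proof.
move=> cf cK fK; split; first exact: continuous_measurable_rV.
have [M fM] := compact_vanish_far cK fK.
have cf2 : continuous (fun x => f x * f x) by move=> x; exact: (continuousM (cf x) (cf x)).
have fM2 x : M < `|x| -> f x * f x = 0 by move=> /fM ->; rewrite mulr0.
have /integrableP[_] := integrable_continuous_support cf2 fM2.
apply: le_lt_trans; apply: ge0_le_integral => //.
- by move=> x _; rewrite lee_fin sqr_ge0.
- by apply/measurable_EFinP; apply: measurable_sqr; exact: continuous_measurable_rV.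
- apply: (measurableT_comp (f := abse)) => //; apply/measurable_EFinP.
  exact: continuous_measurable_rV.
- by move=> x _ /=; rewrite lee_fin -expr2 ler_norm.
Qed.

Lemma L2_loc K f : L2 mu f -> compact K -> mu.-integrable K (EFin \o f).
Proof.
move=> fL cK; have mK := measurable_compact_rV cK.
apply/(integrable_mkcond _ mK).
have KL : L2 mu (\1_K : _ -> R).
  split; first exact: measurable_indic.
  rewrite (eq_integral (fun x => (\1_K x : R)%:E)).
    rewrite integral_indic// setIT.
    by apply: lebesgue_rV_bounded_lty => //; exact: compact_bounded.
  by move=> x _; rewrite indicE; case: (_ \in _); rewrite ?expr1n ?expr0n.
have := L2_integrableM fL KL; congr (integrable _ _ _).
apply/funext => x; rewrite patchE /= indicE; case: (_ \in _); first by rewrite mulr1.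
by rewrite mulr0.
Qed.

Lemma supp_vanish phi x : ~ supp phi x -> phi x = 0.
Proof.
move=> nx; apply: contrapT => /eqP p0; apply: nx; exact: subset_closure.
Qed.

Lemma supp_subset K phi : closed K -> (forall x, ~ K x -> phi x = 0) -> supp phi `<=` K.
Proof.
move=> cK pK; rewrite (iffLR (closure_id K) cK); apply: closure_subset => x /= px.
by apply: contrapT => /pK p0; rewrite p0 eqxx in px.
Qed.

(** Any compact set off which the function vanishes may stand for the support, so supports of
    products and gluings need not be computed. *)
Lemma test_functionP D phi : test_function D phi <->
  smooth phi /\ exists K, [/\ compact K, K `<=` D & forall x, ~ K x -> phi x = 0].
Proof.
split=> [[sp cp pD]|[sp [K [cK KD pK]]]].
  by split=> //; exists (supp phi); split=> // x; exact: supp_vanish.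
have sK := supp_subset (compact_closed_rV cK) pK.
split=> //; last exact: subset_trans KD.
by apply: subclosed_compact sK => //; exact: closed_closure.
Qed.

Definition zext_row D g i : 'rV[R]_d -> R := (fun x => g x 0 i) \_ D.

Lemma W12_L2 D v g : W12 D v g -> L2 mu (v \_ D) /\ forall i, L2 mu (zext_row D g i).
Proof. by move=> [vL gL _]; split=> [|i]; apply/L2P; [exact: vL|exact: gL]. Qed.

Lemma dirichletE D g : dirichlet D g = (\int[mu]_x (\sum_i zext_row D g i x ^+ 2)%:E)%E.
Proof.
rewrite /dirichlet integral_mkcond; apply: eq_integral => x _.
rewrite patchE /zext_row /dotv; case: ifPn => xD.
  by congr (_%:E); apply: eq_bigr => i _; rewrite patchE xD expr2.
by rewrite big1// => i _; rewrite patchE (negPf xD) expr0n.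
Qed.

Lemma W12_weak D v g phi i : W12 D v g -> test_function D phi ->
  (\int[mu]_x ((v \_ D) x * partial i phi x)%:E =
   - \int[mu]_x (zext_row D g i x * phi x)%:E)%E.
Proof.
move=> [_ _ [_ _ W]] tp; have := W phi tp i.
rewrite (integral_restrictM mu D v (partial i phi)).
by rewrite (integral_restrictM mu D (fun x => g x 0 i) phi); exact.
Qed.

Lemma sqr_W12normE D v g phi : test_function D phi ->
  sqr_W12norm D (v \- phi) (g \- grad phi) =
  (\int[mu]_x (((v \_ D) x - phi x) ^+ 2)%:E +
   \int[mu]_x (\sum_i (zext_row D g i x - partial i phi x) ^+ 2)%:E)%E.
Proof.
move=> /test_functionP[sp [K [cK KD pK]]].
have nD x : x \notin D -> ~ K x by move=> /negP xD /KD Dx; apply: xD; rewrite inE.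
have dK i := partial_vanish i (compact_closed_rV cK) pK.
rewrite /sqr_W12norm dirichletE integral_mkcond; congr (_ + _)%E.
  apply: eq_integral => x _; rewrite !patchE; case: ifPn => //= /nD xK.
  by rewrite pK// subr0 expr0n.
apply: eq_integral => x _; congr (_%:E); apply: eq_bigr => i _; rewrite /zext_row !patchE.
case: ifPn => [_|/nD xK]; first by rewrite !mxE.
by rewrite dK// subr0.
Qed.

End sobolev_tools.

(** * Gluing Sobolev functions *)

Section gluing.
Context {R : realType} (d : nat).
Local Notation mu := (lebesgue_rV d : {sigma_finite_measure set 'rV[R]_d -> \bar R}).
Variables (D Ke Kp : set 'rV[R]_d) (v : 'rV[R]_d -> R) (g : 'rV[R]_d -> 'rV[R]_d)
  (eta psi : 'rV[R]_d -> R).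
Hypothesis (vg : W12_0 D v g) (seta : smooth eta) (spsi : smooth psi)
  (cKe : compact Ke) (cKp : compact Kp) (KeD : Ke `<=` D)
  (eta01 : forall x, 0 <= eta x <= 1)
  (etaK : forall x, ~ Ke x -> eta x = 0) (psiK : forall x, ~ Kp x -> psi x = 0).

(** The first argument is left free: it is the extended [v] for the competitor, and [phi] for the
    test function approximating it. *)
Definition glue (u f : 'rV[R]_d -> R) x := eta x * u x + (1 + -1 * eta x) * f x.

(* The weak gradient of [glue u f] when [h] and [k] are the gradients of [u] and [f]. *)
Definition glue_grad (u f : 'rV[R]_d -> R) (h k : 'I_d -> 'rV[R]_d -> R) x : 'rV[R]_d :=
  \row_i (eta x * h i x + ((1 + -1 * eta x) * k i x + (u x - f x) * partial i eta x)).

Local Notation v0 := (v \_ D).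
Local Notation g0 := (zext_row D g).
Local Notation w := (glue v0 psi).
Local Notation G := (glue_grad v0 psi g0 (fun i => partial i psi)).

Let K := Ke `|` Kp.

Lemma glue_vanish u x : ~ K x -> glue u psi x = 0.
Proof.
move=> nK; rewrite /glue etaK; last by move=> ?; apply: nK; left.
by rewrite psiK ?mul0r ?mulr0 ?addr0//; move=> ?; apply: nK; right.
Qed.

Lemma glue_grad_vanish x i : ~ K x -> G x 0 i = 0.
Proof.
move=> nK; have nKe : ~ Ke x by move=> ?; apply: nK; left.
have nKp : ~ Kp x by move=> ?; apply: nK; right.
rewrite !mxE etaK// (partial_vanish i (compact_closed_rV cKe) etaK nKe).
by rewrite (partial_vanish i (compact_closed_rV cKp) psiK nKp) !mulr0 mul0r !addr0.
Qed.

Lemma smooth_onem_eta : smooth (fun x => 1 + -1 * eta x).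
Proof. exact: (smooth_affine 1 (-1) seta). Qed.

Lemma partial_onem_eta i x : partial i (fun x => 1 + -1 * eta x) x = - partial i eta x.
Proof.
rewrite (partialD i x (smooth_cst 1) (smoothM (smooth_cst (-1)) seta)).
by rewrite (partialM i x (smooth_cst (-1)) seta) !partial_cst mulr0 addr0 add0r mulN1r.
Qed.

Lemma eta_grad_bounded : exists2 M : R, 0 <= M & forall i x, `|partial i eta x| <= M.
Proof.
have /choice[C HC] : forall i, exists C : R, 0 <= C /\ forall x, `|partial i eta x| <= C.
  move=> i; have [C C0 HC] := bounded_compact_support
    (smooth_continuous (smooth_partial i seta)) cKe
    (partial_vanish i (compact_closed_rV cKe) etaK).
  by exists C.
exists (\sum_i C i); first by apply: sumr_ge0 => i _; have [] := HC i.
move=> i x; have [_ /(_ x) H] := HC i; apply: (le_trans H).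
by rewrite (bigD1 i)//= lerDl sumr_ge0// => j _; have [] := HC j.
Qed.

Lemma norm_eta x : `|eta x| <= 1.
Proof. by have /andP[e0 e1] := eta01 x; rewrite ger0_norm. Qed.

Lemma L2_v0 : L2 mu v0. Proof. by have [/W12_L2[]] := vg. Qed.

Lemma L2_g0 i : L2 mu (g0 i). Proof. by have [/W12_L2[_]] := vg. Qed.

Lemma measurable_smooth f : smooth f -> measurable_fun [set: 'rV[R]_d] f.
Proof. by move=> /smooth_continuous; exact: continuous_measurable_rV. Qed.

Lemma glue_L2 : L2 mu w.
Proof.
apply: L2D; first exact: (L2_bounded L2_v0 (measurable_smooth seta) norm_eta).
apply: (L2_compact_support (K := Kp)) => //.
  exact: (smooth_continuous (smoothM smooth_onem_eta spsi)).
by move=> x /psiK ->; rewrite mulr0.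
Qed.

Lemma glue_grad_L2 i : L2 mu (fun x => G x 0 i).
Proof.
have [M M0 HM] := eta_grad_bounded.
have dpK := partial_vanish i (compact_closed_rV cKp) psiK.
have sde := smooth_partial i seta.
rewrite (_ : (fun x => G x 0 i) = (fun x => eta x * g0 i x + ((1 + -1 * eta x) * partial i psi x +
   (partial i eta x * v0 x + partial i eta x * (-1 * psi x))))); last first.
  by apply/funext => x; rewrite /glue_grad mxE; ring.
apply: L2D; first exact: (L2_bounded (L2_g0 i) (measurable_smooth seta) norm_eta).
apply: L2D.
  apply: (L2_compact_support (K := Kp)) => //.
    exact: (smooth_continuous (smoothM smooth_onem_eta (smooth_partial i spsi))).
  by move=> x /dpK ->; rewrite mulr0.
apply: L2D; first exact: (L2_bounded L2_v0 (measurable_smooth sde) (HM i)).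
apply: (L2_compact_support (K := Kp)) => //.
  exact: (smooth_continuous (smoothM sde (smoothM (smooth_cst (-1)) spsi))).
by move=> x /psiK ->; rewrite !mulr0.
Qed.

(** The integrand [w d_i zeta + G_i zeta] equals [v0 d_i(eta zeta) + g0_i eta zeta] plus
    [d_i((1 - eta) psi zeta)]. The first part integrates to zero because [eta zeta] is a test
    function on [D], the second because it is the derivative of a compactly supported function;
    [zeta] itself may reach outside [D]. *)
Lemma glue_weak zeta Kz i : smooth zeta -> compact Kz -> (forall x, ~ Kz x -> zeta x = 0) ->
  (\int[mu]_x (w x * partial i zeta x)%:E = - \int[mu]_x (G x 0 i * zeta x)%:E)%E.
Proof.
move=> sz cKz zK.
have dzK := partial_vanish i (compact_closed_rV cKz) zK.
have L2c f : smooth f -> (forall x, ~ Kz x -> f x = 0) -> L2 mu f.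
  by move=> sf fK; apply: (L2_compact_support (K := Kz)) => //; exact: smooth_continuous.
have sdz := smooth_partial i sz; have sde := smooth_partial i seta.
have sez := smoothM seta sz.
have tez : test_function D (fun x => eta x * zeta x).
  apply/test_functionP; split; first exact: sez.
  by exists Ke; split=> // x /etaK ->; rewrite mul0r.
have ezK x : ~ Kz x -> eta x * zeta x = 0 by move=> /zK ->; rewrite mulr0.
pose P := fun x => v0 x * partial i (fun x => eta x * zeta x) x.
pose Q := fun x => g0 i x * (eta x * zeta x).
have iP : mu.-integrable setT (EFin \o P).
  apply: L2_integrableM; first exact: L2_v0.
  apply: L2c; first exact: (smooth_partial i sez).
  exact: (partial_vanish i (compact_closed_rV cKz) ezK).
have iQ : mu.-integrable setT (EFin \o Q).
  by apply: L2_integrableM; [exact: L2_g0|exact: L2c].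
have PQ : (\int[mu]_x (P x)%:E = - \int[mu]_x (Q x)%:E)%E.
  by have [W _] := vg; exact: (W12_weak i W tez).
pose h := fun x => (1 + -1 * eta x) * (psi x * zeta x).
have spz := smoothM spsi sz.
have sh : smooth h by exact: (smoothM smooth_onem_eta spz).
have hK x : ~ Kz x -> h x = 0 by move=> /zK zx; rewrite /h zx !mulr0.
pose S := partial i h.
have SK := partial_vanish i (compact_closed_rV cKz) hK.
have iS : mu.-integrable setT (EFin \o S).
  have [M SM] := compact_vanish_far cKz SK.
  exact: (integrable_continuous_support (smooth_continuous (smooth_partial i sh)) SM).
have S0 : (\int[mu]_x (S x)%:E = 0)%E.
  have [M hM] := compact_vanish_far cKz hK.
  apply: (integral_partial _ (smooth_continuous (smooth_partial i sh)) hM).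
  by move=> x; have [] := smooth_is_derive i x sh.
pose A := fun x => w x * partial i zeta x; pose B := fun x => G x 0 i * zeta x.
have iA : mu.-integrable setT (EFin \o A).
  by apply: L2_integrableM; [exact: glue_L2|exact: L2c].
have iB : mu.-integrable setT (EFin \o B).
  by apply: L2_integrableM; [exact: glue_grad_L2|exact: L2c].
have AB x : A x + B x = (P x + Q x) + S x.
  rewrite /A /B /P /Q /S /h /glue_grad mxE /glue (partialM i x seta sz).
  rewrite (partialM i x smooth_onem_eta spz) (partialM i x spsi sz) partial_onem_eta.
  ring.
have ABint : (\int[mu]_x (A x)%:E + \int[mu]_x (B x)%:E = 0)%E.
  rewrite -(integralD measurableT iA iB).
  rewrite (eq_integral (fun x => ((EFin \o P) x + (EFin \o Q) x + (EFin \o S) x)%E)); last first.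
    by move=> x _ /=; rewrite -!EFinD AB.
  rewrite (integralD measurableT (integrableD measurableT iP iQ) iS).
  rewrite (integralD measurableT iP iQ) S0 adde0 [X in (X + _)%E]PQ addeC subee//.
  exact: (integrable_fin_num measurableT iQ).
have fB := integrable_fin_num measurableT iB.
by rewrite -[LHS]adde0 -(subee fB) addeA ABint add0e.
Qed.

End gluing.

Lemma lee_combination (R : realType) (a b : \bar R) (c C : R) :
  (0 <= a)%E -> (0 <= b)%E -> 0 <= c -> 2 <= C -> 1 + c <= C ->
  (a + (2%:E * b + c%:E * a) <= C%:E * (a + b))%E.
Proof.
move=> a0 b0 c0 C2 cC.
have E : ((1 + c)%:E * a = a + c%:E * a)%E.
  by rewrite EFinD ge0_muleDl ?lee_fin ?ler01// mul1e.
have -> : (a + (2%:E * b + c%:E * a) = (1 + c)%:E * a + 2%:E * b)%E.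
  by rewrite E [RHS]addeAC addeA.
by rewrite ge0_muleDr// leeD// lee_wpmul2r.
Qed.

(** * The glued function belongs to the zero-trace space of every set containing its support *)

Section gluing_W12_0.
Context {R : realType} (d : nat).
Local Notation mu := (lebesgue_rV d : {sigma_finite_measure set 'rV[R]_d -> \bar R}).

Lemma restrict_vanish (T : Type) (D : set T) (f : T -> R) :
  (forall x, ~ D x -> f x = 0) -> f \_ D = f.
Proof.
move=> fD; apply/funext => x; rewrite patchE; case: ifPn => // /negP xD.
by rewrite fD// => Dx; apply: xD; rewrite inE.
Qed.

Variables (D Ke Kp : set 'rV[R]_d) (v : 'rV[R]_d -> R) (g : 'rV[R]_d -> 'rV[R]_d)
  (eta psi : 'rV[R]_d -> R).
Hypothesis (vg : W12_0 D v g) (seta : smooth eta) (spsi : smooth psi)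
  (cKe : compact Ke) (cKp : compact Kp) (KeD : Ke `<=` D)
  (eta01 : forall x, 0 <= eta x <= 1)
  (etaK : forall x, ~ Ke x -> eta x = 0) (psiK : forall x, ~ Kp x -> psi x = 0).

Local Notation v0 := (v \_ D).
Local Notation g0 := (zext_row D g).
Local Notation w := (glue eta v0 psi).
Local Notation G := (glue_grad eta v0 psi g0 (fun i => partial i psi)).

Variable D' : set 'rV[R]_d.
Hypothesis KD' : Ke `|` Kp `<=` D'.

Let wD' x : ~ D' x -> w x = 0.
Proof. by move=> nD; apply: (glue_vanish etaK psiK) => /KD'. Qed.

Let GD' i x : ~ D' x -> G x 0 i = 0.
Proof. by move=> nD; apply: (glue_grad_vanish D v g cKe cKp etaK psiK i) => /KD'. Qed.

Lemma zext_row_glue i : zext_row D' G i = (fun x => G x 0 i).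
Proof. by apply: restrict_vanish => x; exact: GD'. Qed.

Let wL2 : L2 mu w := glue_L2 vg seta spsi cKp eta01 psiK.
Let GL2 i : L2 mu (fun x => G x 0 i) :=
  glue_grad_L2 vg seta spsi cKe cKp eta01 etaK psiK i.

Lemma glue_W12 : W12 D' w G.
Proof.
split.
- by rewrite /in_Lp (restrict_vanish wD'); apply/L2P.
- move=> i; rewrite /in_Lp (_ : _ \_ D' = zext_row D' G i)// zext_row_glue.
  by apply/L2P; exact: GL2.
- split.
  + by move=> K cK _; apply: L2_loc.
  + by move=> i K cK _; apply: L2_loc => //; exact: GL2.
  + move=> zeta /test_functionP[sz [Kz [cKz _ zK]]] i.
    rewrite (integral_restrictM mu D' w (partial i zeta)).
    rewrite (integral_restrictM mu D' (fun x => G x 0 i) zeta).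
    rewrite (restrict_vanish wD') (restrict_vanish (@GD' i)).
    exact: (glue_weak vg seta spsi cKe cKp KeD eta01 etaK psiK i sz cKz zK).
Qed.

Lemma smooth_glue phi : smooth phi -> smooth (glue eta phi psi).
Proof.
by move=> sp; exact: (smoothD (smoothM seta sp) (smoothM (smooth_onem_eta seta) spsi)).
Qed.

Lemma partial_glue phi i x : smooth phi -> partial i (glue eta phi psi) x =
  glue_grad eta phi psi (fun i => partial i phi) (fun i => partial i psi) x 0 i.
Proof.
move=> sp; rewrite (partialD i x (smoothM seta sp) (smoothM (smooth_onem_eta seta) spsi)).
rewrite (partialM i x seta sp) (partialM i x (smooth_onem_eta seta) spsi).
rewrite (partial_onem_eta seta) /glue_grad mxE; ring.
Qed.

Lemma measurable_sum_sqr (F : 'I_d -> 'rV[R]_d -> R) :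
  (forall i, measurable_fun [set: 'rV[R]_d] (F i)) ->
  measurable_fun [set: 'rV[R]_d] (fun x => \sum_i F i x ^+ 2).
Proof. by move=> mF; apply: measurable_sum => i; exact: measurable_sqr. Qed.

(** The approximating test function is [glue eta phi psi]. Its difference from [w] is
    [eta (v0 - phi)], with gradient [eta (g0 - grad phi) + (v0 - phi) grad eta], so the squared
    distance is at most [C] times that of [v] to [phi]. *)
Lemma glue_W12_0 : W12_0 D' w G.
Proof.
split; first exact: glue_W12.
move=> e e0; have [M M0 HM] := eta_grad_bounded seta cKe etaK.
(* It must dominate 2, the weight of the gradient error, and [1 + 2 d M^2], that of the function
   error. As [C >= 1], the tolerance [e / C] suffices: [C (e / C)^2 <= e^2]. *)
pose C := 3 + 2 * d%:R * M ^+ 2.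
have dM : 0 <= d%:R * M ^+ 2 by rewrite mulr_ge0 ?sqr_ge0.
have C1 : 1 <= C by rewrite /C -mulrA; lra.
have C0 : 0 < C by apply: lt_le_trans C1.
have e1 : 0 < e / C by rewrite divr_gt0.
have [[vL gL W] /(_ _ e1)[phi tphi]] := vg.
rewrite (sqr_W12normE v g tphi) => small.
have /test_functionP[sphi [Kphi [cKphi KphiD phiK]]] := tphi.
have schi := smooth_glue sphi.
have tchi : test_function D' (glue eta phi psi).
  apply/test_functionP; split; first exact: schi.
  exists (Ke `|` Kp); split; [exact: compactU|exact: KD'|].
  by move=> x; exact: (glue_vanish etaK psiK).
exists (glue eta phi psi); first exact: tchi.
rewrite (sqr_W12normE w G tchi) (restrict_vanish wD').
pose A x := v0 x - phi x; pose B i x := g0 i x - partial i phi x.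
have mA : measurable_fun [set: 'rV[R]_d] A.
  by apply: measurable_funB; [case: (L2_v0 vg)|exact: measurable_smooth].
have mB i : measurable_fun [set: 'rV[R]_d] (B i).
  apply: measurable_funB; [by case: (L2_g0 vg i)|].
  exact: (measurable_smooth (smooth_partial i sphi)).
have E1 : (\int[mu]_x ((w x - glue eta phi psi x) ^+ 2)%:E <= \int[mu]_x (A x ^+ 2)%:E)%E.
  rewrite (eq_integral (fun x => ((eta x * A x) ^+ 2)%:E)); last first.
    by move=> x _; congr (_%:E); rewrite /A /glue; ring.
  apply: le_integral_ge0.
  - by move=> x; exact: sqr_ge0.
  - move=> x; rewrite exprMn ler_piMl ?sqr_ge0//.
    by rewrite -real_normK ?num_real// expr_le1// norm_eta.
  - by apply: measurable_sqr; apply: measurable_funM => //; exact: measurable_smooth.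
  - exact: measurable_sqr.
have E2 : (\int[mu]_x (\sum_i (zext_row D' G i x - partial i (glue eta phi psi) x) ^+ 2)%:E <=
    2%:E * \int[mu]_x (\sum_i B i x ^+ 2)%:E +
    (2 * d%:R * M ^+ 2)%:E * \int[mu]_x (A x ^+ 2)%:E)%E.
  rewrite (eq_integral (fun x =>
    (\sum_i (eta x * B i x + A x * partial i eta x) ^+ 2)%:E)); last first.
    move=> x _; congr (_%:E); apply: eq_bigr => i _.
    rewrite zext_row_glue (partial_glue i x sphi) /glue_grad !mxE /A /B; ring.
  rewrite -integral_lin2 //; first last.
  - exact: measurable_sqr.
  - exact: measurable_sum_sqr.
  - by move=> x; exact: sqr_ge0.
  - by move=> x; apply: sumr_ge0 => i _; exact: sqr_ge0.
  - by rewrite mulr_ge0 ?sqr_ge0.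
  apply: le_integral_ge0.
  - by move=> x; apply: sumr_ge0 => i _; exact: sqr_ge0.
  - move=> x; have -> : 2 * d%:R * M ^+ 2 * A x ^+ 2 = \sum_(i < d) 2 * (M ^+ 2 * A x ^+ 2).
      by rewrite sumr_const card_ord -mulr_natl; ring.
    rewrite mulr_sumr -big_split/=; apply: ler_sum => i _.
    have H1 : (eta x * B i x) ^+ 2 <= B i x ^+ 2.
      rewrite exprMn ler_piMl ?sqr_ge0//.
      by rewrite -real_normK ?num_real// expr_le1// norm_eta.
    have H2 : (A x * partial i eta x) ^+ 2 <= M ^+ 2 * A x ^+ 2.
      rewrite exprMn mulrC ler_wpM2r ?sqr_ge0//.
      by rewrite -[leLHS]real_normK ?num_real// lerXn2r ?nnegrE.
    have := sqr_ge0 (eta x * B i x - A x * partial i eta x).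
    move: H1 H2; rewrite !expr2; lra.
  - apply: measurable_sum_sqr => i; apply: measurable_funD; apply: measurable_funM => //.
      exact: measurable_smooth.
    exact: (measurable_smooth (smooth_partial i seta)).
  - apply: measurable_funD; apply: measurable_funM => //; first exact: measurable_sum_sqr.
    exact: measurable_sqr.
have IA0 : (0 <= \int[mu]_x (A x ^+ 2)%:E)%E.
  by apply: integral_ge0 => x _; rewrite lee_fin sqr_ge0.
have IB0 : (0 <= \int[mu]_x (\sum_i B i x ^+ 2)%:E)%E.
  by apply: integral_ge0 => x _; rewrite lee_fin sumr_ge0// => i _; exact: sqr_ge0.
apply: (le_lt_trans (leeD E1 E2)).
apply: (@le_lt_trans _ _ (C%:E * (\int[mu]_x (A x ^+ 2)%:E + \int[mu]_x (\sum_i B i x ^+ 2)%:E))%E).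
  by apply: lee_combination => //; rewrite /C -mulrA; lra.
apply: (@lt_le_trans _ _ (C%:E * ((e / C) ^+ 2)%:E)%E).
  by rewrite lte_pmul2l// ?lte_fin.
rewrite -EFinM lee_fin expr_div_n mulrCA ler_piMr ?sqr_ge0//.
by rewrite ler_pdivrMr ?exprn_gt0// mul1r expr2 ler_peMr// ltW.
Qed.

End gluing_W12_0.

(** * The energy estimate *)

Section energy.
Context {R : realType} (d : nat).
Local Notation mu := (lebesgue_rV d : {sigma_finite_measure set 'rV[R]_d -> \bar R}).

(** The difference of the two sides is [(t p - q)^2 / t]. Here [p] is the main term, with weight
    near 1, and [q] an error. *)
Lemma young_sqr (t p q : R) : 0 < t -> (p + q) ^+ 2 <= (1 + t) * p ^+ 2 + (1 + t^-1) * q ^+ 2.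
Proof.
move=> t0; rewrite -subr_ge0.
have -> : (1 + t) * p ^+ 2 + (1 + t^-1) * q ^+ 2 - (p + q) ^+ 2 = t^-1 * (t * p - q) ^+ 2.
  have tn : t != 0 by rewrite gt_eqF.
  by field.
by rewrite mulr_ge0 ?sqr_ge0// invr_ge0 ltW.
Qed.

(** Here [s] is a derivative of [phi] and [u m] the gluing term. Young's inequality is used twice,
    to split off [u m] and to compare [s] with [g], hence [(1 + t)^2]. In between, convexity of the
    square reduces to [g^2] and [s^2], both bounded by the same [X]. *)
Lemma energy_pointwise (t et th g s u m M c : R) : 0 < t -> 0 <= et <= 1 -> 0 <= th <= 1 ->
  (u * m) ^+ 2 <= c ->
  (et * g + ((1 + -1 * et) * (th * s) + u * m)) ^+ 2 <=
  (1 + t) ^+ 2 * g ^+ 2 + ((1 + t) * (1 + t^-1)) * (g - s) ^+ 2 + (1 + t^-1) * c.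
Proof.
move=> t0 /andP[et0 et1] /andP[th0 th1] umc.
have t1 : 0 <= 1 + t by lra.
have ti : 0 <= t^-1 by rewrite invr_ge0 ltW.
rewrite addrA; apply: (le_trans (young_sqr _ _ t0)); apply: lerD; last first.
  by rewrite ler_wpM2l// addr_ge0.
rewrite expr2 -!mulrA -mulrDr ler_wpM2l//.
have c1 : (et * g + (1 + -1 * et) * (th * s)) ^+ 2 <= et * g ^+ 2 + (1 - et) * (th * s) ^+ 2.
  rewrite -subr_ge0.
  have -> : et * g ^+ 2 + (1 - et) * (th * s) ^+ 2 - (et * g + (1 + -1 * et) * (th * s)) ^+ 2 =
    et * (1 - et) * (g - th * s) ^+ 2 by ring.
  by rewrite mulr_ge0 ?sqr_ge0// mulr_ge0// subr_ge0.
have c2 : (th * s) ^+ 2 <= s ^+ 2 by rewrite exprMn ler_piMl ?sqr_ge0// expr_le1.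
have c3 : s ^+ 2 <= (1 + t) * g ^+ 2 + (1 + t^-1) * (g - s) ^+ 2.
  have := young_sqr g (- (g - s)) t0; rewrite sqrrN.
  by rewrite (_ : g + - (g - s) = s)//; ring.
have c4 : g ^+ 2 <= (1 + t) * g ^+ 2 + (1 + t^-1) * (g - s) ^+ 2.
  have : 0 <= t * g ^+ 2 by rewrite mulr_ge0 ?sqr_ge0// ltW.
  have : 0 <= (1 + t^-1) * (g - s) ^+ 2 by rewrite mulr_ge0 ?sqr_ge0// addr_ge0.
  lra.
apply: (le_trans c1).
set X := (1 + t) * g ^+ 2 + (1 + t^-1) * (g - s) ^+ 2 in c3 c4 *.
have e1 : et * g ^+ 2 <= et * X by rewrite ler_wpM2l.
have e2 : (1 - et) * (th * s) ^+ 2 <= (1 - et) * X.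
  by rewrite ler_wpM2l ?subr_ge0//; apply: le_trans c3.
lra.
Qed.

Lemma small_sqr (C e : R) : 0 <= C -> 0 < e -> exists2 t : R, 0 < t & C * t ^+ 2 <= e.
Proof.
move=> C0 e0; have C1 : 0 < C + 1 by lra.
pose t := Num.min 1 (e / (C + 1)).
have t0 : 0 < t by rewrite lt_min ltr01 divr_gt0.
have t1 : t <= 1 by rewrite ge_min lexx.
exists t => //; have tt : t ^+ 2 <= t by rewrite expr2 ler_piMr// ltW.
have te : t * (C + 1) <= e by rewrite -ler_pdivlMr// ge_min lexx orbT.
have := ler_wpM2l C0 tt; have := ltW t0; nra.
Qed.

Lemma small_dilation (a : \bar R) (e : R) : (0 <= a)%E -> 0 < e ->
  exists2 t : R, 0 < t & (((1 + t) ^+ 2)%:E * a <= a + e%:E)%E.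
Proof.
case: a => [r||]//; last by move=> _ e0; exists 1 => //; rewrite addye ?leey.
rewrite lee_fin => r0 e0; have r1 : 0 < r + 1 by lra.
(* For [t <= 1], [(1 + t)^2 - 1 <= 3 t]; [r + 1] keeps the denominator positive. *)
pose t := Num.min 1 (e / (3 * (r + 1))).
have r3 : 0 < 3 * (r + 1) by rewrite mulr_gt0.
have t0 : 0 < t by rewrite lt_min ltr01 divr_gt0.
exists t => //; rewrite -EFinM -EFinD lee_fin.
have t1 : t <= 1 by rewrite ge_min lexx.
have te : t * (3 * (r + 1)) <= e by rewrite -ler_pdivlMr// ge_min lexx orbT.
have tr : 0 <= t * r by rewrite mulr_ge0// ltW.
have : t * (t * r) <= t * r by rewrite ler_piMl.
rewrite sqrrD expr1n mul1r -mulr_natl !expr2; lra.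
Qed.

(** [D'] is quantified after [K], [V], [w], [G], so that one competitor serves all the sets
    [yn(Omega)] containing [K]. The allowance [dl] is spent as [dl/2] on the factor [(1 + t)^2],
    [dl/4] on the distance from [v] to [phi], and [dl/4] on thresholding. *)
Lemma interior_competitor (D E : set 'rV[R]_d) v g (dl : R) : 0 < dl -> compact E ->
  W12_0 D v g -> ge1_near D E v ->
  exists K V w G, [/\ compact K /\ K `<=` D°, [/\ open V, E `<=` V & V `<=` K],
    {ae mu, forall x, V x -> 1 <= w x} &
    forall D' : set 'rV[R]_d, K `<=` D' ->
      W12_0 D' w G /\ (dirichlet D' G <= dirichlet D g + dl%:E)%E].
Proof.
move=> dl0 cE vg [U [oU EU UD vU]].
have [eta [Ke [V [seta eta01 [cKe KeU] etaK [oV EV VK eta1]]]]] := cutoff_exists cE oU EU.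
have [M M0 HM] := eta_grad_bounded seta cKe etaK.
have a0 : (0 <= dirichlet D g)%E.
  rewrite dirichletE; apply: integral_ge0 => x _; rewrite lee_fin sumr_ge0// => i _.
  exact: sqr_ge0.
have dl2 : 0 < dl / 2 by rewrite divr_gt0.
have dl4 : 0 < dl / 4 by rewrite divr_gt0.
have [t t0 Ht] := small_dilation a0 dl2.
have ti : 0 < t^-1 by rewrite invr_gt0.
have muKe : (mu Ke < +oo)%E.
  apply: lebesgue_rV_bounded_lty; [exact: measurable_compact_rV|exact: compact_bounded].
have muKe0 : (0 <= mu Ke)%E by exact: measure_ge0.
(* The weight of [(v0 - psi)^2] in the error once the [d] coordinates are summed. *)
pose b := (1 + t^-1) * M ^+ 2 * d%:R.
have b0 : 0 <= b by rewrite !mulr_ge0 ?sqr_ge0// addr_ge0// ltW.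
pose C1 := (1 + t) * (1 + t^-1) + 2 * b.
have C10 : 0 <= C1.
  by apply: addr_ge0; apply: mulr_ge0 => //; apply: addr_ge0 => //; exact: ltW.
have [e1 e10 He1] := small_sqr C10 dl4.
(* The 8 comes from [(v0 - psi)^2 <= 2 (v0 - phi)^2 + 2 (2 e)^2]. *)
have C20 : 0 <= 8 * b * fine (mu Ke) by apply: mulr_ge0; [rewrite mulr_ge0|exact: fine_ge0].
have [e e0 He] := small_sqr C20 dl4.
have [_ /(_ _ e10)[phi tphi]] := vg; rewrite (sqr_W12normE v g tphi) => small.
have /test_functionP[sphi [Kphi [cKphi KphiD phiK]]] := tphi.
have [psi [spsi psi0 psi_dist psi_th]] := soft_threshold e0 sphi.
pose Kp := [set x | e <= `|phi x|].
have cphi := smooth_continuous sphi.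
have clKp : closed Kp.
  have cn : continuous (fun x => `|phi x|).
    by move=> x; exact: (continuous_comp (cphi x) (@norm_continuous _ _ (phi x))).
  apply: (closed_comp (f := fun x => `|phi x|) (D := [set r | e <= r])); last exact: closed_ge.
  by move=> x _; exact: cn.
have KpKphi : Kp `<=` Kphi.
  move=> x; rewrite /Kp /= => ex; apply: contrapT => /phiK p0.
  by move: ex; rewrite p0 normr0 leNgt e0.
have cKp : compact Kp by exact: subclosed_compact KpKphi.
have psiK x : ~ Kp x -> psi x = 0.
  by move=> /negP; rewrite /Kp /= -ltNge => /ltW; exact: psi0.
have KeD : Ke `<=` D by exact: subset_trans UD.
pose v0 := v \_ D; pose g0 := zext_row D g.
exists (Ke `|` Kp), V, (glue eta v0 psi), (glue_grad eta v0 psi g0 (fun i => partial i psi)).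
split.
- split; first exact: compactU.
  move=> x [Kex|Kpx].
    have UDi : U `<=` D° by rewrite -open_subsetE.
    by apply: UDi; exact: KeU.
  pose W := [set x | phi x != 0].
  have oW : open W.
    have := @open_comp _ _ phi [set r | r != 0] (fun x _ => cphi x); apply.
    exact: open_neq.
  have WD : W `<=` D.
    move=> z; rewrite /W /= => pz; apply: KphiD; apply: contrapT => /phiK p0.
    by rewrite p0 eqxx in pz.
  have WDi : W `<=` D° by rewrite -open_subsetE.
  suff Wx : W x by exact: (WDi x Wx).
  apply/eqP => p0; move: Kpx; rewrite /Kp /= p0 normr0 leNgt e0.
  by [].
- split => //; exact: subset_trans (@subsetUl _ _ _).
- apply: filterS vU => x vx Vx; rewrite /glue eta1// mulr1 subrr mul0r addr0 mul1r.
  have Ux : U x by apply: KeU; exact: VK.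
  by rewrite /v0 patchE mem_set; [exact: vx|exact: UD].
move=> D' KD'.
split; first exact: (glue_W12_0 vg seta spsi cKe cKp KeD eta01 etaK psiK KD').
rewrite (dirichletE D').
set G := glue_grad _ _ _ _ _.
have zG i : zext_row D' G i = (fun x => G x 0 i) := zext_row_glue D v g cKe cKp etaK psiK KD' i.
pose A x := v0 x - phi x; pose B i x := g0 i x - partial i phi x.
pose X x := \sum_i g0 i x ^+ 2; pose Y x := \sum_i B i x ^+ 2.
have mA : measurable_fun [set: 'rV[R]_d] A.
  by apply: measurable_funB; [case: (L2_v0 vg)|exact: measurable_smooth].
have mg i : measurable_fun [set: 'rV[R]_d] (g0 i) by case: (L2_g0 vg i).
have mB i : measurable_fun [set: 'rV[R]_d] (B i).
  by apply: measurable_funB; [exact: mg|exact: (measurable_smooth (smooth_partial i sphi))].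
have mX : measurable_fun [set: 'rV[R]_d] X by exact: measurable_sum_sqr.
have mY : measurable_fun [set: 'rV[R]_d] Y by exact: measurable_sum_sqr.
have X0 x : 0 <= X x by apply: sumr_ge0 => i _; exact: sqr_ge0.
have Y0 x : 0 <= Y x by apply: sumr_ge0 => i _; exact: sqr_ge0.
have mKe := measurable_compact_rV cKe.
pose chi : 'rV[R]_d -> R := \1_Ke.
have chi0 x : 0 <= chi x by rewrite /chi indicE.
have mchi : measurable_fun [set: 'rV[R]_d] chi by exact: measurable_indic.
pose Z x := 1 * (A x ^+ 2) + 1 * Y x.
have Z0 x : 0 <= Z x by rewrite /Z !mul1r addr_ge0// sqr_ge0.
have mZ : measurable_fun [set: 'rV[R]_d] Z.
  by apply: measurable_funD; apply: measurable_funM => //; exact: measurable_sqr.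
pose S x := C1 * Z x + (8 * b * e ^+ 2) * chi x.
have be0 : 0 <= 8 * b * e ^+ 2 by apply: mulr_ge0; [rewrite mulr_ge0|exact: sqr_ge0].
have S0 x : 0 <= S x by rewrite /S addr_ge0// mulr_ge0.
have mS : measurable_fun [set: 'rV[R]_d] S.
  by apply: measurable_funD; apply: measurable_funM.
have ptw x : \sum_i zext_row D' G i x ^+ 2 <= (1 + t) ^+ 2 * X x + 1 * S x.
  apply: (@le_trans _ _ (\sum_i ((1 + t) ^+ 2 * g0 i x ^+ 2 + ((1 + t) * (1 + t^-1)) * B i x ^+ 2 +
      (1 + t^-1) * (M ^+ 2 * (2 * A x ^+ 2 + 8 * e ^+ 2 * chi x))))).
    apply: ler_sum => i _; rewrite zG /G /glue_grad mxE.
    have [th th01 ->] := psi_th x; apply: energy_pointwise => //.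
    (* Off [Ke] the gradient of [eta] vanishes; this is why the constant [8 e^2] carries the
       indicator [chi] and has a finite integral. *)
    have [Kex|nKex] := pselect (Ke x); last first.
      rewrite (partial_vanish i (compact_closed_rV cKe) etaK nKex) mulr0 expr0n /=.
      apply: mulr_ge0; first exact: sqr_ge0.
      have A2 := sqr_ge0 (A x); have E2 : 0 <= 8 * e ^+ 2 * chi x.
        by apply: mulr_ge0; [apply: mulr_ge0 => //; exact: sqr_ge0|exact: chi0].
      lra.
    rewrite /chi indicE mem_set// mulr1 exprMn mulrC.
    have m2 : partial i eta x ^+ 2 <= M ^+ 2.
      by rewrite -real_normK ?num_real// lerXn2r ?nnegrE.
    apply: (le_trans (ler_wpM2r (sqr_ge0 _) m2)); rewrite ler_wpM2l ?sqr_ge0//.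
    have d2 : (phi x - psi x) ^+ 2 <= (2 * e) ^+ 2.
      by rewrite -real_normK ?num_real// lerXn2r ?nnegrE// mulr_ge0// ltW.
    have -> : v0 x - psi x = A x + (phi x - psi x) by rewrite /A; ring.
    have := sqr_ge0 (A x - (phi x - psi x)); move: d2; rewrite !expr2; lra.
  rewrite !big_split/= -!mulr_sumr sumr_const card_ord -mulr_natl /S /C1 /b /Z /X /Y.
  set sY := \sum_i B i x ^+ 2; set sX := \sum_i g0 i x ^+ 2.
  have sY0 : 0 <= sY := Y0 x.
  have r1 : 0 <= (1 + t^-1) * M ^+ 2 * d%:R * sY by rewrite mulr_ge0.
  have r2 : 0 <= (1 + t) * (1 + t^-1) * A x ^+ 2.
    by apply: mulr_ge0; [apply: mulr_ge0; apply: addr_ge0 => //; exact: ltW|exact: sqr_ge0].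
  lra.
apply: (@le_trans _ _ (\int[mu]_x ((1 + t) ^+ 2 * X x + 1 * S x)%:E)%E).
  apply: le_integral_ge0 => //.
  - by move=> x; apply: sumr_ge0 => i _; exact: sqr_ge0.
  - apply: measurable_sum_sqr => i; rewrite zG.
    by case: (glue_grad_L2 vg seta spsi cKe cKp eta01 etaK psiK i).
  - by apply: measurable_funD; apply: measurable_funM.
rewrite integral_lin2//; last by rewrite sqr_ge0.
rewrite mul1e integral_lin2// integral_lin2//; first last.
- exact: measurable_sqr.
- by move=> x; exact: sqr_ge0.
rewrite !mul1e integral_indic// setIT -dirichletE.
have F1 : (C1%:E * (\int[mu]_x (A x ^+ 2)%:E + \int[mu]_x (Y x)%:E) <= (dl / 4)%:E)%E.
  apply: (@le_trans _ _ (C1%:E * (e1 ^+ 2)%:E)%E); last by rewrite -EFinM lee_fin.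
  by apply: lee_wpmul2l; [rewrite lee_fin|exact: ltW small].
have F2 : ((8 * b * e ^+ 2)%:E * mu Ke <= (dl / 4)%:E)%E.
  rewrite -(fineK (x := mu Ke)); last by rewrite ge0_fin_numE.
  by rewrite -EFinM lee_fin mulrAC.
apply: (le_trans (leeD Ht (leeD F1 F2))).
by rewrite -addeA leeD2l// -!EFinD lee_fin; lra.
Qed.

End energy.

(** * The inequality for the relative capacity, and the conclusion *)

Lemma limn_esup_relCap_le (R : realType) d (A O omega : set 'rV[R]_d)
    (y : 'rV[R]_d -> 'rV[R]_d) (yn : nat -> 'rV[R]_d -> 'rV[R]_d) :
  (0 < d)%N -> {uniform A, yn @ \oo --> y} -> homeomorphism_onto_image A y ->
  (forall n, {within A, continuous (yn n)}) -> O `<=` A -> compact omega -> omega `<=` A ->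
  (limn_esup (fun n => relCap (yn n @` omega) (yn n @` O)) <= relCap (y @` omega) (y @` O))%E.
Proof.
move=> d0 yn_y hy cyn OA co oA; apply: le_ereal_inf_tmp => _ [v [g [vg vE ->]]].
have cE := compact_image hy.1 oA co.
apply/lee_addgt0Pr => dl dl0.
have [K [V [w [G [[cK KD] [oV EV VK] Vw comp]]]]] := interior_competitor dl0 cE vg vE.
apply: limn_esup_le_near.
have near1 := compact_subset_image_near yn_y d0 hy cyn OA cK KD.
have near2 := image_subset_near yn_y cE oV EV oA.
apply: filterS (filterI near1 near2) => n [KDn EVn].
have [wG energy] := comp _ KDn; apply: le_trans energy.
apply: ereal_inf_lbound; exists w, G; split=> //.
by exists V; split=> //; exact: subset_trans KDn.
Qed.

Theorem proposition4p5 (R : realType) (d : nat) (hd : (2 <= d)%N)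
    (Omega omega : set 'rV[R]_d)
    (y : 'rV[R]_d -> 'rV[R]_d) (yn : nat -> 'rV[R]_d -> 'rV[R]_d)
    (Omega_nonempty : Omega !=set0)
    (Omega_sc : simply_connected Omega)
    (Omega_dom : bounded_lipschitz_domain Omega)
    (omega_dom : domain omega)
    (omega_Omega : compactly_contained omega Omega)
    (y_homeo : homeomorphism_onto_image (closure Omega) y)
    (yn_homeo : forall n, homeomorphism_onto_image (closure Omega) (yn n))
    (yn_y : {uniform closure Omega, yn @ \oo --> y}) :
  ((3 <= d)%N ->
    (limn_esup (fun n => Cap (yn n @` closure omega))
      <= Cap (y @` closure omega))%E) /\
  (limn_esup (fun n => relCap (yn n @` closure omega) (yn n @` Omega))
    <= relCap (y @` closure omega) (y @` Omega))%E.
Proof.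
have [co oO] := omega_Omega.
have OA : Omega `<=` closure Omega by exact: subset_closure.
have oA := subset_trans oO OA.
split=> [_|]; first exact: (limn_esup_Cap_le yn_y y_homeo.1 co oA).
apply: (limn_esup_relCap_le _ yn_y y_homeo _ OA co oA); first exact: ltnW.
by move=> n; exact: (yn_homeo n).1.
Qed.
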